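(* Let $d\ge 1$, $m\ge 2$, let $\mu_0,\mu_1$ be probability measures on $\mathbb{Z}_m^d$, $\pi\in\Pi(\mu_0,\mu_1)$ a coupling, and let the base process be either the nearest-neighbor random walk (NNRW) or the uniform random walk (URW), with the associated jump operators $\mathcal{M}$, jump rate $\lambda(m)$, interpolant $X^{\mathrm I}$, marginals $\mu_t=p^{\mathrm I}_t$ and rates $q^{\mathrm M}_t$ defined in the context. Let $\eta\in(0,1)$ be the early-stopping parameter and let $\{t_k\}_{k=0}^K$ be the time-discretization of $[0,1-\eta]$ given by $t_k=1-(1+h)^{-k}$, where $h\in(0,1)$ (so that $t_0=0$ and $t_K=1-\eta$), and let $h_{k+1}=t_{k+1}-t_k$. Let $u^{\mathrm M,\theta^\star}:[0,1]\times(\mathbb{Z}_m^d)^2\to\mathbb{R}_+$ be an approximate score, $q^{\mathrm M,\theta^\star}_t(x,y)=q(x,y)\,u^{\mathrm M,\theta^\star}_t(x,y)$, and let $X^{\theta^\star}$ be the associated generative process defined in the context. Assume that for some $\tilde\varepsilon\ge 0$, $$\sum_{k=0}^{K-1}h_{k+1}\,\mathbb{E}\Big[\sum_{\sigma\in\mathcal{M}}\Big\{q^{\mathrm M,\theta^\star}_{t_k}\,\varphi\Big(\frac{q^{\mathrm M}_{t_k}}{q^{\mathrm M,\theta^\star}_{t_k}}\Big)+\big(q^{\mathrm M,\theta^\star}_{t_k}-q^{\mathrm M}_{t_k}\big)^2\Big\}\big(X^{\mathrm I}_{t_k},\sigma(X^{\mathrm I}_{t_k})\big)\Big]\le\tilde\varepsilon^2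 ,$$ where $\varphi(a)=a\log a+1-a$ for $a\ge0$. Then, for both NNRW and URW, there is a universal constant $C>0$ such that $$\mathrm{KL}\big(\mu_{1-\eta}\,\big|\,\mathrm{Law}(X^{\theta^\star}_{1-\eta})\big)\le C\Big[m^2\eta^{-2}\,\tilde\varepsilon\big(\sqrt{|\mathcal{M}|}+\tilde\varepsilon\big)+(\lambda(m))^2d^2m^2\,h\,\log(\eta^{-1})\log(m\eta^{-1})\Big].$$
   Context: $\mathbb{Z}_m^d=\{0,\dots,m-1\}^d$ (coordinatewise arithmetic mod $m$). $\Pi(\mu_0,\mu_1)$: couplings of $\mu_0,\mu_1$. $\mathrm{KL}(\mu|\nu)=\int\log(d\mu/d\nu)\,d\mu$ if $\mu\ll\nu$, else $+\infty$. A universal constant is one independent of all parameters and data of the problem. Base processes: homogeneous continuous-time Markov chains on $\mathbb{Z}_m^d$ with generator $q$, a finite collection $\mathcal{M}$ of jump operators $\sigma:\mathbb{Z}_m^d\to\mathbb{Z}_m^d$ and jump rate $\lambda(m)$: each $\sigma\in\mathcal{M}$ is applied at rate $q(x,\sigma(x))=\lambda(m)$, there are no other jumps, and $q(x,x)=-\lambda(m)|\mathcal{M}|$. - NNRW: $\mathcal{M}=\{\sigma^\ell_+,\sigma^\ell_-\}_{\ell=1}^d$, $\sigma^\ell_\pm(x)=x\pm e_\ell \pmod m$; $\lambda(m)=1/2$, $q(x,x)=-d$. The coordinates are independent, each displacement over a time $t$ being $N^+_t-N^-_t \pmod m$ with $N^\pm_t$ independent Poisson($t/2$), i.e. $p_{t+s|s}(y|x)=\prod_{i=1}^d\sum_{k\in\mathbb{Z}}e^{-t}I_{|y^i-x^i+km|}(t)$,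 with $I_b$ the modified Bessel function of the first kind. (If $m=2$, $\sigma^\ell_+$ and $\sigma^\ell_-$ are counted as two jump operators, each of rate $1/2$.) - URW: $\mathcal{M}=\{\sigma^\ell_n:\ell\in\{1,\dots,d\},\,n\in\{1,\dots,m-1\}\}$, $\sigma^\ell_n(x)=x+ne_\ell\pmod m$; $\lambda(m)=1/m$, $q(x,x)=-d(m-1)/m$. $p_{t|s}(y|x)$, $0\le s\le t\le 1$, are the transition probabilities of the base process. Put $\tilde\pi(x_0,x_1)=\pi(x_0,x_1)/p_{1|0}(x_1|x_0)$. Interpolant: $(X^{\mathrm I}_0,X^{\mathrm I}_1)\sim\pi$ and, given $(X^{\mathrm I}_0,X^{\mathrm I}_1)=(x_0,x_1)$, $(X^{\mathrm I}_t)_{t\in[0,1]}$ has the law of the base process conditioned to start at $x_0$ and end at $x_1$. Its time marginals are $\mu_t(x)=p^{\mathrm I}_t(x)=\sum_{x_0,x_1}p_{t|0}(x|x_0)p_{1|t}(x_1|x)\tilde\pi(x_0,x_1)$. Score and projected rates: $$u^{\mathrm M}_t(x,y)=\frac{\sum_{x_0,x_1}p_{1|t}(x_1|y)\,p_{t|0}(x|x_0)\,\tilde\pi(x_0,x_1)}{p^{\mathrm I}_t(x)},\qquad q^{\mathrm M}_t(x,y)=q(x,y)\,u^{\mathrm M}_t(x,y)\ (x\ne y),$$ so $q^{\mathrm M}_t(x,\sigma(x))=\lambda(m)u^{\mathrm M}_t(x,\sigma(x))$ and $q^{\mathrm M,\theta^\star}_t(x,\sigma(x))=\lambda(m)u^{\mathrm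 M,\theta^\star}_t(x,\sigma(x))$ for $\sigma\in\mathcal{M}$. Here $b\,\varphi(a/b)=a\log(a/b)-a+b$, with the usual conventions when $a$ or $b$ vanishes ($+\infty$ if $b=0<a$, $0$ if $a=b=0$). Generative process: $X^{\theta^\star}_0\sim\mu_0$; for each $k$, given $X^{\theta^\star}_{t_k}$, on $[t_k,t_{k+1})$ the process jumps from any current state $x$ to $\sigma(x)$, $\sigma\in\mathcal{M}$, at the constant rate $\lambda(m)\,u^{\mathrm M,\theta^\star}_{t_k}(X^{\theta^\star}_{t_k},\sigma(X^{\theta^\star}_{t_k}))$ (rates frozen at the state occupied at time $t_k$), and has no other jumps. It is stopped at $t_K=1-\eta$. *)

(* Defs.v *)
(* MathComp / MathComp-Analysis world. *)
From HB Require Import structures.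
From mathcomp Require Import all_boot all_order all_algebra.
From mathcomp Require Import all_classical all_reals all_analysis.

Set Implicit Arguments.
Unset Strict Implicit.
Unset Printing Implicit Defensive.

Import Order.TTheory GRing.Theory Num.Theory.
Import numFieldNormedType.Exports.

Local Open Scope classical_set_scope.
Local Open Scope ring_scope.

(* The discrete torus (Z/mZ)^d.  ['Z_m] has m elements only when 1 < m. *)
Notation torus d m := 'rV['Z_m]_d (only parsing).

Inductive walk := NNRW | URW.

(* The jump operators form an indexed family rather than a set of maps: for
   m = 2 the two nearest-neighbor operators along an axis are the same map but
   count as two operators.  For URW the index (l, n) stands for the
   displacement n.+1 along the axis l, with 1 <= n.+1 <= m - 1. *)
Definition jumps (b : walk) (d m : nat) : finType :=
  match b with
  | NNRW => ('I_d * bool)%type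
  | URW => ('I_d * 'I_m.-1)%type
  end.

Definition jump (b : walk) (d m : nat) :
    jumps b d m -> torus d m -> torus d m :=
  match b return jumps b d m -> torus d m -> torus d m with
  | NNRW => fun s x =>
      if s.2 then x + delta_mx 0 s.1 else x - delta_mx 0 s.1
  | URW => fun s x => x + delta_mx 0 s.1 *+ (s.2 : nat).+1
  end.

Definition jump_rate (R : realType) (b : walk) (m : nat) : R :=
  match b with NNRW => 2^-1 | URW => m%:R^-1 end.

Section MarkovChains.
Context {R : realType} {T : finType}.

Definition is_prob (mu : T -> R) : Prop :=
  (forall x, 0 <= mu x) /\ \sum_x mu x = 1.

Definition is_coupling (mu0 mu1 : T -> R) (pi : T -> T -> R) : Prop :=
  [/\ forall x y, 0 <= pi x y,
      forall x, \sum_y pi x y = mu0 x &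
      forall y, \sum_x pi x y = mu1 y].

(* KL divergence of two measures on a finite set given by their point masses;
   the density of mu with respect to nu is then the ratio of the masses. *)
Definition KL (mu nu : T -> R) : \bar R :=
  if [forall x, (nu x == 0) ==> (mu x == 0)]
  then (\sum_x mu x * ln (mu x / nu x))%:E
  else +oo%E.

(* Generator of the chain that applies the operator [sigma s] at rate [r s]. *)
Definition generator (J : finType) (sigma : J -> T -> T) (r : J -> R)
    (x y : T) : R :=
  \sum_(s : J) r s * ((sigma s x == y)%:R - (x == y)%:R).

Definition gen_pow (Q : T -> T -> R) (n : nat) : T -> T -> R :=
  iter n (fun A x y => \sum_z Q x z * A z y) (fun x y => (x == y)%:R).

(* Transition probabilities exp (t Q) of the homogeneous chain generated by Q. *)
Definition semigroup (Q : T -> T -> R) (t : R) (x y : T) : R :=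
  limn (series (fun n => t ^+ n / n`!%:R * gen_pow Q n x y)).

(* Probability that a homogeneous chain with transition function [p], sitting
   at [x] at time [s], visits the given states at the given later times. *)
Fixpoint path_prob (p : R -> T -> T -> R) (s : R) (x : T) (l : seq (R * T)) :
    R :=
  if l is (t, y) :: l' then p (t - s) x y * path_prob p t y l' else 1.

End MarkovChains.

Section Processes.
Context {R : realType} {T : finType}.
Context {dsp : measure_display} {Omega : measurableType dsp}.
Variable P : probability Omega R.
Implicit Type X : R -> Omega -> T.

Definition cylinder X (l : seq (R * T)) : set Omega :=
  [set w | forall tx, tx \in l -> X tx.1 w = tx.2].

Definition rv_on (b : R) X : Prop :=
  forall t x, 0 <= t <= b -> measurable (X t @^-1` [set x]).

Definition law X (t : R) (x : T) : R := fine (P (X t @^-1` [set x])).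

(* The end points have law [pi] and, given these, the finite-dimensional
   distributions are those of the chain with transition function [p] started
   at x0 and conditioned to be at x1 at time 1. *)
Definition interpolant (p : R -> T -> T -> R) (pi : T -> T -> R) X : Prop :=
  rv_on 1 X /\
  forall (x0 x1 : T) (l : seq (R * T)),
    path <=%R 0 (rcons (unzip1 l) 1) ->
    P (cylinder X ((0, x0) :: rcons l (1, x1))) =
    (pi x0 x1 * (path_prob p 0 x0 (rcons l (1, x1)) / p 1 x0 x1))%:E.

(* X 0 has law [mu0]; conditionally on the past up to the grid time [tg k] and
   on X (tg k) = z, X evolves up to time [tg k.+1] as a homogeneous chain with
   generator [Q k z], frozen throughout the interval.  The right end point is
   included since there is almost surely no jump at a deterministic time. *)
Definition frozen_process (mu0 : T -> R) (tg : nat -> R) (K : nat)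
    (Q : nat -> T -> T -> T -> R) X : Prop :=
  [/\ rv_on (tg K) X,
      forall x, P (X 0 @^-1` [set x]) = (mu0 x)%:E &
      forall (k : nat) (z : T) (past fut : seq (R * T)), (k < K)%N ->
        all (fun t => 0 <= t <= tg k) (unzip1 past) ->
        path <=%R (tg k) (unzip1 fut) ->
        all (fun t => t <= tg k.+1) (unzip1 fut) ->
        P (cylinder X (past ++ (tg k, z) :: fut)) =
        (P (cylinder X (rcons past (tg k, z))) *
         (path_prob (semigroup (Q k z)) (tg k) z fut)%:E)%E].

End Processes.

Section Scores.
Context {R : realType} {T J : finType}.
Variables (sigma : J -> T -> T) (lam : R).

Definition base_trans : R -> T -> T -> R :=
  semigroup (generator sigma (fun=> lam)).

Variable pi : T -> T -> R.

Definition pi_tilde (x0 x1 : T) : R := pi x0 x1 / base_trans 1 x0 x1.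

Definition interp_marginal (t : R) (x : T) : R :=
  \sum_x0 \sum_x1
    base_trans t x0 x * base_trans (1 - t) x x1 * pi_tilde x0 x1.

Definition score (t : R) (x y : T) : R :=
  (\sum_x0 \sum_x1
     base_trans (1 - t) y x1 * base_trans t x0 x * pi_tilde x0 x1)
  / interp_marginal t x.

(* Rate at which the operator [sigma s] is applied under the score [u]; when
   several operators map x to the same state, each one carries its own rate. *)
Definition op_rate (u : R -> T -> T -> R) (t : R) (x : T) (s : J) : R :=
  lam * u t x (sigma s x).

Definition phi (a : R) : R := a * ln a + 1 - a.

(* b * phi (a / b) for a, b >= 0, extended to b = 0. *)
Definition phi_persp (a b : R) : \bar R :=
  if b == 0 then (if a == 0 then 0%E else +oo%E) else (b * phi (a / b))%:E.

Definition score_loss (u : R -> T -> T -> R) (t : R) (x : T) : \bar R :=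
  (\sum_(s : J)
     (phi_persp (op_rate score t x s) (op_rate u t x s) +
      ((op_rate u t x s - op_rate score t x s) ^+ 2)%:E))%E.

(* Generator in force between [tg k] and [tg k.+1] when the state at time
   [tg k] is z: the rates are evaluated at z, the jumps start from the current
   state. *)
Definition frozen_generator (u : R -> T -> T -> R) (tg : nat -> R) (k : nat)
    (z : T) : T -> T -> R :=
  generator sigma (op_rate u (tg k) z).

End Scores.

Definition time_grid (R : realType) (h : R) (k : nat) : R := 1 - (1 + h) ^- k.

(* Main.v *)
(* Conditionally on X^I_{t_k} = z (rather than through the Markovian projection),
   the interpolant is on [t_k, t_{k+1}] the Doob transform p(z,y) F(y) of the base
   chain p by a positive function F with (p F)(z) = 1, and the mean of the jump
   rate lam F(sigma y) / F(y) stays equal to the exact rate q^M_{t_k}(z, sigma z).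
   Two estimates bound the relative entropy of p F with respect to the law with
   frozen rates b_sigma.
   - Tilting: convexity of log P_b in the logarithms of the rates b gives
     KL(pF | P_b) <= tau sum_sigma (lam u log(lam/b) - lam + b) + p(F log F)(z),
     where u = (p F)(sigma z), so that only the entropy of F remains.
   - The entropy p_t(F_t log F_t), F_t = p_{tau-t} F, has derivative
     sum_sigma lam (u log u - u + 1) at t = 0 and second derivative at most
     L^2 (2 log rho + 1), where L bounds sum_sigma lam F(sigma x) / F(x) and rho
     bounds F(sigma x) / F(x) and its inverse.
   Hence each step costs at most tau_k times the entropic part of the loss, plus
   tau_k^2 L^2 (2 log rho + 1). At distance s from the final time a Harnack
   inequality for the heat kernel gives L = 6 lam d m / s and rho = 6 m / s: along
   one axis the base chain conditioned on its end points makes O(m) jumps on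
   average. With tau_k = h s the errors add up to the discretization term, and the
   chain rule for KL adds up the steps. *)

Require Import Defs.
From HB Require Import structures.
From mathcomp Require Import all_boot all_order all_algebra.
From mathcomp Require Import all_classical all_reals all_analysis.
From mathcomp Require Import ring lra zify.
Import Order.TTheory GRing.Theory Num.Theory.
Import numFieldNormedType.Exports.
Set Implicit Arguments.
Unset Strict Implicit.
Unset Printing Implicit Defensive.

Local Open Scope classical_set_scope.
Local Open Scope ring_scope.

(** * Kernels on a finite set *)

Section Kernels.
Context {R : realType} {T : finType}.
Implicit Types (A B C Q : T -> T -> R) (f g : T -> R) (t : R).

Definition kmul A B x y : R := \sum_z A x z * B z y.
Definition kid x y : R := (x == y :> T)%:R.
Definition kapp A f x : R := \sum_y A x y * f y.

Lemma kmulA A B C : kmul A (kmul B C) = kmul (kmul A B) C.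
Proof.
apply/funext => x; apply/funext => y; rewrite /kmul.
under eq_bigr do rewrite mulr_sumr.
rewrite exchange_big/=; apply: eq_bigr => z _.
by rewrite mulr_suml; apply: eq_bigr => w _; rewrite mulrA.
Qed.

Lemma kapp_kmul A B f : kapp (kmul A B) f = kapp A (kapp B f).
Proof.
apply/funext => x; rewrite /kapp /kmul.
under eq_bigr do rewrite mulr_suml.
rewrite exchange_big/=; apply: eq_bigr => z _.
by rewrite mulr_sumr; apply: eq_bigr => w _; rewrite mulrA.
Qed.

Lemma kmul1 A : kmul A kid = A.
Proof.
apply/funext => x; apply/funext => y; rewrite /kmul (bigD1 y)//= /kid eqxx mulr1.
by rewrite big1 ?addr0// => z /negbTE ->; rewrite mulr0.
Qed.

Lemma k1mul A : kmul kid A = A.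
Proof.
apply/funext => x; apply/funext => y; rewrite /kmul (bigD1 x)//= /kid eqxx mul1r.
by rewrite big1 ?addr0// => z; rewrite eq_sym => /negbTE ->; rewrite mul0r.
Qed.

Lemma kapp1 f : kapp kid f = f.
Proof.
apply/funext => x; rewrite /kapp (bigD1 x)//= /kid eqxx mul1r.
by rewrite big1 ?addr0// => z; rewrite eq_sym => /negbTE ->; rewrite mul0r.
Qed.

Lemma kmulDl A B C : kmul (fun x y => A x y + B x y) C =
  (fun x y => kmul A C x y + kmul B C x y).
Proof.
apply/funext => x; apply/funext => y; rewrite /kmul -big_split/=.
by apply: eq_bigr => z _; rewrite mulrDl.
Qed.

Lemma kmulDr A B C : kmul C (fun x y => A x y + B x y) =
  (fun x y => kmul C A x y + kmul C B x y).
Proof.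
apply/funext => x; apply/funext => y; rewrite /kmul -big_split/=.
by apply: eq_bigr => z _; rewrite mulrDr.
Qed.

Lemma kmulZl a A C : kmul (fun x y => a * A x y) C =
  (fun x y => a * kmul A C x y).
Proof.
apply/funext => x; apply/funext => y; rewrite /kmul mulr_sumr.
by apply: eq_bigr => z _; rewrite mulrA.
Qed.

Lemma kmulZr a A C : kmul C (fun x y => a * A x y) =
  (fun x y => a * kmul C A x y).
Proof.
apply/funext => x; apply/funext => y; rewrite /kmul mulr_sumr.
by apply: eq_bigr => z _; rewrite mulrCA.
Qed.

Lemma gen_pow0 Q : gen_pow Q 0 = kid.
Proof. by []. Qed.

Lemma gen_powS Q n : gen_pow Q n.+1 = kmul Q (gen_pow Q n).
Proof. by []. Qed.

Lemma gen_pow_comm A Q n : kmul A Q = kmul Q A ->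
  kmul A (gen_pow Q n) = kmul (gen_pow Q n) A.
Proof.
move=> AQ; elim: n => [|n IH]; first by rewrite gen_pow0 kmul1 k1mul.
by rewrite gen_powS kmulA AQ -kmulA IH kmulA.
Qed.

Lemma gen_pow_scale a Q n :
  gen_pow (fun x y => a * Q x y) n = (fun x y => a ^+ n * gen_pow Q n x y).
Proof.
elim: n => [|n IH].
  by apply/funext => x; apply/funext => y; rewrite expr0 mul1r.
rewrite !gen_powS IH kmulZl kmulZr exprS.
by apply/funext => x; apply/funext => y; rewrite mulrA.
Qed.

Lemma gen_pow_ge0 Q n x y : (forall x y, 0 <= Q x y) -> 0 <= gen_pow Q n x y.
Proof.
move=> Q0; elim: n x y => [|n IH] x y; first exact: ler0n.
by rewrite gen_powS; apply: sumr_ge0 => z _; apply: mulr_ge0.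
Qed.

(** The sum of the absolute values of all entries dominates every row sum, so each further power
    costs at most one more factor. This geometric bound makes the exponential series converge for
    all times. *)
Lemma gen_pow_bound Q : exists2 q, 0 <= q &
  forall n x y, `|gen_pow Q n x y| <= q ^+ n.
Proof.
exists (\sum_x \sum_y `|Q x y|).
  by apply: sumr_ge0 => x _; apply: sumr_ge0.
move=> n; elim: n => [|n IH] x y.
  by rewrite /gen_pow /= expr0; case: (x == y); rewrite ?normr1 ?normr0.
rewrite gen_powS (le_trans (ler_norm_sum _ _ _))// exprS.
rewrite [X in _ <= X * _](bigD1 x)//= mulrDl mulr_suml.
apply: ler_wpDr.
  apply: mulr_ge0; last by apply: exprn_ge0; apply: sumr_ge0 => ? _; exact: sumr_ge0.
  by apply: sumr_ge0 => ? _; exact: sumr_ge0.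
by apply: ler_sum => z _; rewrite normrM ler_wpM2l.
Qed.

(** Term by term comparison with [c] times the exponential series at [q] times the modulus of
    [t]. *)
Lemma cvg_exp_type (b : nat -> R) (c q t : R) :
  0 <= c -> 0 <= q -> (forall n, `|b n| <= c * q ^+ n) ->
  cvgn (pseries (fun n => b n / n`!%:R) t).
Proof.
move=> c0 q0 bq; apply: normed_cvg => /=.
apply: (@series_le_cvg _ _ (fun n => c * exp_coeff (q * `|t|) n)) => [n|n|n|].
- exact: normr_ge0.
- by rewrite mulr_ge0// /exp_coeff /= divr_ge0// exprn_ge0// mulr_ge0.
- rewrite /exp_coeff /= !normrM normfV normrX normr_nat exprMn.
  rewrite mulrAC -mulrA.
  have -> : c * (q ^+ n * `|t| ^+ n / n`!%:R) = c * q ^+ n * (`|t| ^+ n / n`!%:R).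
    by rewrite !mulrA.
  by rewrite ler_wpM2r// divr_ge0// exprn_ge0.
- have -> : series (fun n => c * exp_coeff (q * `|t|) n) =
    (fun n => c *: series (exp_coeff (q * `|t|)) n).
    by apply/funext => n; rewrite /series/= scaler_sumr.
  by apply: is_cvgZr; exact: is_cvg_series_exp_coeff.
Qed.

Lemma semigroup_pseries Q x y :
  (fun t => semigroup Q t x y) =
  (fun t => limn (pseries (fun n => gen_pow Q n x y / n`!%:R) t)).
Proof.
apply/funext => t; rewrite /semigroup /pseries; congr (limn (series _)).
by apply/funext => n; rewrite mulrC [RHS]mulrAC mulrA.
Qed.

Lemma cvg_semigroup Q t x y :
  series (fun n => t ^+ n / n`!%:R * gen_pow Q n x y) @ \oo -->
  semigroup Q t x y.
Proof.
have [q q0 Qq] := gen_pow_bound Q.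
suff : cvgn (series (fun n => t ^+ n / n`!%:R * gen_pow Q n x y)) by [].
have -> : (fun n => t ^+ n / n`!%:R * gen_pow Q n x y) =
  (fun n => gen_pow Q n x y / n`!%:R * t ^+ n).
  by apply/funext => n; rewrite mulrC [RHS]mulrAC mulrA.
apply: (@cvg_exp_type _ 1 q) => // n; by rewrite mul1r.
Qed.

Lemma eq_series_cvg (a b : nat -> R) (l : R) : a =1 b ->
  series a @ \oo --> l -> series b @ \oo --> l.
Proof. by move=> /funext ->. Qed.

Lemma cvg_series_lin (I : finType) (w : I -> R) (a : I -> nat -> R) (l : I -> R) :
  (forall i, series (a i) @ \oo --> l i) ->
  series (fun n => \sum_i w i * a i n) @ \oo --> \sum_i w i * l i.
Proof.
move=> al.
have -> : series (fun n => \sum_i w i * a i n) =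
    (fun n => \sum_i w i * series (a i) n).
  apply/funext => n; rewrite /series/= exchange_big/=.
  by apply: eq_bigr => i _; rewrite mulr_sumr.
apply: cvg_big => [|i _]; first exact: add_continuous.
exact: cvgM (cvg_cst _) (al i).
Qed.

Lemma cvg_kmul_semigroup A Q t x y :
  series (fun n => t ^+ n / n`!%:R * kmul A (gen_pow Q n) x y) @ \oo -->
  kmul A (semigroup Q t) x y.
Proof.
have := @cvg_series_lin T (A x) _ _ (fun z => @cvg_semigroup Q t z y).
apply: eq_series_cvg => n.
by rewrite /kmul mulr_sumr; apply: eq_bigr => z _; rewrite mulrCA.
Qed.

Lemma semigroup_comm A Q t : kmul A Q = kmul Q A ->
  kmul A (semigroup Q t) = kmul (semigroup Q t) A.
Proof.
move=> AQ; apply/funext => x; apply/funext => y.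
rewrite -(cvg_lim (@Rhausdorff R) (@cvg_kmul_semigroup A Q t x y)).
apply: cvg_lim => //.
have -> : kmul (semigroup Q t) A x y = \sum_z A z y * semigroup Q t x z.
  by apply: eq_bigr => z _; rewrite mulrC.
have := @cvg_series_lin T (A^~ y) _ _ (fun z => @cvg_semigroup Q t x z).
apply: eq_series_cvg => n.
rewrite (gen_pow_comm _ AQ) /kmul mulr_sumr; apply: eq_bigr => z _.
by rewrite mulrC -!mulrA.
Qed.

Lemma is_derive_semigroup Q t x y :
  is_derive t 1 (fun t => semigroup Q t x y) (kmul Q (semigroup Q t) x y).
Proof.
have [q q0 Qq] := gen_pow_bound Q.
rewrite semigroup_pseries.
(* Formal differentiation turns [c k] into [c k.+1], so all the derived series are of the same type
   and converge. *)
pose c k n := gen_pow Q (n + k) x y / n`!%:R.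
have dc k : pseries_diffs (c k) = c k.+1.
  apply/funext => n; rewrite /pseries_diffs /c factS natrM invfM addSnnS.
  by rewrite mulrCA mulVKf.
have Cc k K : cvgn (pseries (c k) K).
  apply: (@cvg_exp_type (fun n => gen_pow Q (n + k) x y) (q ^+ k) q) => //.
    exact: exprn_ge0.
  by move=> n; rewrite -exprD addnC.
have -> : (fun n => gen_pow Q n x y / n`!%:R) = c 0%N.
  by apply/funext => n; rewrite /c addn0.
have -> : kmul Q (semigroup Q t) x y = limn (pseries (pseries_diffs (c 0%N)) t).
  rewrite dc; apply/esym/cvg_lim => //.
  have := @cvg_kmul_semigroup Q Q t x y.
  apply: eq_series_cvg => n.
  by rewrite -gen_powS -[RHS]/(c 1%N n * t ^+ n) /c addn1 mulrC [RHS]mulrAC mulrA.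
apply: (@pseries_snd_diffs _ _ (`|t| + 1)); rewrite ?dc//.
by rewrite [ltRHS]ger0_norm ?addr_ge0// ltrDl.
Qed.

Lemma semigroup0 Q : semigroup Q 0 = kid.
Proof.
apply/funext => x; apply/funext => y; apply/cvg_lim => //.
apply: cvg_near_cst; exists 1%N => // -[//|N] _.
rewrite /series/= big_nat_recl//= expr0 fact0 divr1 mul1r big1 ?addr0// => i _.
by rewrite expr0n/= mul0r mul0r.
Qed.

Lemma semigroupZ Q t : semigroup Q t = semigroup (fun x y => t * Q x y) 1.
Proof.
apply/funext => x; apply/funext => y; rewrite /semigroup.
congr (limn (series _)); apply/funext => n.
by rewrite gen_pow_scale expr1n mulrA mul1r (mulrC _^-1).
Qed.

Lemma is_derive_fsum (I : finType) (h : I -> R -> R) (dh : I -> R) t :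
  (forall i, is_derive t 1 (h i) (dh i)) ->
  is_derive t 1 (fun t => \sum_i h i t) (\sum_i dh i).
Proof.
move=> hd; elim: (index_enum I) => [|i r IH].
  rewrite big_nil (_ : (fun _ => _) = cst 0); last first.
    by apply/funext => s; rewrite big_nil.
  exact: is_derive_cst.
rewrite big_cons (_ : (fun _ => _) = h i + (fun s => \sum_(j <- r) h j s)).
  exact: is_deriveD.
by apply/funext => s; rewrite big_cons.
Qed.

Lemma is_derive_reflect (f : R -> R) (df c t : R) :
  is_derive (c - t) 1 f df -> is_derive t 1 (fun s => f (c - s)) (- df).
Proof.
move=> fd; have gd : is_derive t 1 (fun s => c - s) (-1).
  have -> : (fun s : R => c - s) = cst c - id by [].
  by apply: is_derive_eq; rewrite sub0r.
have := @is_derive1_comp _ f (fun s => c - s) t df (-1) fd gd.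
by rewrite mulrN1.
Qed.

Lemma is_derive_mul (f g : R -> R) (df dg t : R) :
  is_derive t 1 f df -> is_derive t 1 g dg ->
  is_derive t 1 (fun s => f s * g s) (df * g t + f t * dg).
Proof.
move=> fd gd; have -> : (fun s => f s * g s) = f * g by [].
by apply: is_derive_eq; rewrite -![_ *: _]/(_ * _) addrC [X in X + _]mulrC.
Qed.

(* The product below is constant in [t]. *)
Lemma semigroupD Q1 Q2 c : kmul Q1 Q2 = kmul Q2 Q1 ->
  semigroup (fun x y => Q1 x y + Q2 x y) c = kmul (semigroup Q1 c) (semigroup Q2 c).
Proof.
move=> Q12; set Q := fun x y => Q1 x y + Q2 x y.
apply/funext => x; apply/funext => y.
pose f t := \sum_z kmul (semigroup Q1 t) (semigroup Q2 t) x z * semigroup Q (c - t) z y.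
have -> : semigroup Q c x y = f 0.
  by rewrite /f !semigroup0 k1mul subr0 -/(kmul _ _ _ _) k1mul.
have -> : kmul (semigroup Q1 c) (semigroup Q2 c) x y = f c.
  by rewrite /f subrr semigroup0 -/(kmul _ _ _ _) kmul1.
apply: is_derive_0_is_cst => t.
pose E1 := semigroup Q1 t; pose E2 := semigroup Q2 t; pose E := semigroup Q (c - t).
pose D z := kmul (kmul Q1 E1) E2 x z + kmul E1 (kmul Q2 E2) x z.
have Dz z : is_derive t 1 (fun t => kmul (semigroup Q1 t) (semigroup Q2 t) x z) (D z).
  rewrite /D /kmul -big_split; apply: is_derive_fsum => w.
  by apply: is_derive_mul; exact: is_derive_semigroup.
(* The derivative vanishes: commutation moves [Q1] and [Q2] to the right of [E1] and [E2], where
   they cancel against [Q]. *)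
have -> : 0 = \sum_z (D z * E z y + kmul E1 E2 x z * (- kmul Q E z y)).
  under eq_bigr do rewrite mulrN; rewrite sumrB; apply/esym/eqP; rewrite subr_eq0; apply/eqP.
  rewrite -[RHS]/(kmul (kmul E1 E2) (kmul Q E) x y).
  pose D' x z := kmul (kmul Q1 E1) E2 x z + kmul E1 (kmul Q2 E2) x z.
  rewrite -[LHS]/(kmul D' E x y) kmulA; congr (kmul _ _ x y).
  have Q1E2 : kmul Q1 E2 = kmul E2 Q1 by exact: semigroup_comm.
  have Q1E1 : kmul Q1 E1 = kmul E1 Q1 by exact: semigroup_comm.
  have Q2E2 : kmul Q2 E2 = kmul E2 Q2 by exact: semigroup_comm.
  by rewrite /D' /Q kmulDr Q1E1 Q2E2 -!kmulA Q1E2.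
apply: is_derive_fsum => z; apply: is_derive_mul => //.
exact: (@is_derive_reflect (fun s => semigroup Q s z y) _ _ _ (@is_derive_semigroup Q (c - t) z y)).
Qed.

End Kernels.

Section KernelFacts.
Context {R : realType} {T : finType}.
Implicit Types (A B Q : T -> T -> R) (f : T -> R) (t : R).

(** The times are absorbed into the generators: [s * Q] and [t * Q] commute, and [semigroupD]
    applies at time 1. *)
Lemma semigroup_add Q s t :
  semigroup Q (s + t) = kmul (semigroup Q s) (semigroup Q t).
Proof.
rewrite semigroupZ (semigroupZ Q s) (semigroupZ Q t).
rewrite -semigroupD; last first.
  by rewrite !kmulZl !kmulZr; apply/funext => x; apply/funext => y; rewrite mulrCA.
by congr (semigroup _ 1); apply/funext => x; apply/funext => y; rewrite mulrDl.
Qed.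

Lemma semigroup_scalar a t :
  semigroup (fun x y : T => a * kid x y) t = fun x y => expR (t * a) * kid x y.
Proof.
apply/funext => x; apply/funext => y; apply: cvg_lim => //.
have gp n : gen_pow (fun x y : T => a * kid x y) n = fun x y => a ^+ n * kid x y.
  rewrite gen_pow_scale; apply/funext => x'; apply/funext => y'; congr (_ * _).
  by elim: n x' y' => // n IH x' y'; rewrite gen_powS k1mul IH.
have := cvgM (@is_cvg_series_exp_coeff R (t * a)) (cvg_cst (kid x y)).
have -> : (series (exp_coeff (t * a)) \* cst (kid x y)) =
    series (fun n => t ^+ n / n`!%:R * gen_pow (fun x y : T => a * kid x y) n x y).
  apply/funext => N; rewrite /series/= mulr_suml; apply: eq_bigr => n _.
  by rewrite gp /exp_coeff/= exprMn mulrA (mulrAC (t ^+ n)).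
exact.
Qed.

Lemma semigroup_term_le Q t n x y : 0 <= t -> (forall x y, 0 <= Q x y) ->
  t ^+ n / n`!%:R * gen_pow Q n x y <= semigroup Q t x y.
Proof.
move=> t0 Q0; have term0 k : 0 <= t ^+ k / k`!%:R * gen_pow Q k x y.
  by rewrite mulr_ge0 ?gen_pow_ge0// divr_ge0// exprn_ge0.
apply: le_trans (_ : series (fun n => t ^+ n / n`!%:R * gen_pow Q n x y) n.+1 <= _).
  rewrite /series/= big_nat_recr//=; apply: ler_wpDl => //.
  exact: sumr_ge0.
apply: nondecreasing_cvgn_le; last exact: (cvgP _ (@cvg_semigroup _ _ Q t x y)).
apply/nondecreasing_seqP => k.
by rewrite /series/= big_nat_recr//= ler_wpDr.
Qed.

Lemma semigroup_ge0 Q t x y : 0 <= t -> (forall x y, 0 <= Q x y) ->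
  0 <= semigroup Q t x y.
Proof.
move=> t0 Q0; apply: le_trans (@semigroup_term_le Q t 0 x y t0 Q0).
by rewrite mulr_ge0 ?gen_pow_ge0// divr_ge0// exprn_ge0.
Qed.

(** The total mass is constant in time: [Q] commutes with its semigroup, hence can be put on the
    right in the derivative, where its row sums vanish. *)
Lemma semigroup_sum1 Q t x : (forall x, \sum_y Q x y = 0) ->
  \sum_y semigroup Q t x y = 1.
Proof.
move=> Q0; transitivity (\sum_y semigroup Q 0 x y); last first.
  rewrite semigroup0 (bigD1 x)//= /kid eqxx big1 ?addr0// => y.
  by rewrite eq_sym => /negbTE ->.
apply: (@is_derive_0_is_cst _ (fun t => \sum_y semigroup Q t x y)) => {}t.
have E : \sum_y kmul Q (semigroup Q t) x y = 0.
  rewrite semigroup_comm// /kmul exchange_big/= big1// => z _.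
  by rewrite -mulr_sumr Q0 mulr0.
rewrite -[X in is_derive _ _ _ X]E.
by apply: is_derive_fsum => y; exact: is_derive_semigroup.
Qed.

Lemma is_derive_kapp Q f t x :
  is_derive t 1 (fun t => kapp (semigroup Q t) f x)
    (kapp Q (kapp (semigroup Q t) f) x).
Proof.
rewrite -kapp_kmul /kapp; apply: is_derive_fsum => y.
have -> : kmul Q (semigroup Q t) x y * f y =
    kmul Q (semigroup Q t) x y * f y + semigroup Q t x y * 0.
  by rewrite mulr0 addr0.
apply: (@is_derive_mul _ _ (fun=> f y)); exact: is_derive_semigroup.
Qed.

End KernelFacts.

(** * Semigroups generated by commuting jumps *)

Section Jumps.
Context {R : realType} {T J : finType}.
Variable sigma : J -> T -> T.
Hypothesis sigmaC : forall i j x, sigma i (sigma j x) = sigma j (sigma i x).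
Implicit Types (r : J -> R) (A : T -> T -> R) (f : T -> R) (t : R).

(** The generator without its diagonal part. Its entries are nonnegative when the rates are, so its
    exponential is a series of nonnegative terms indexed by the number of jumps. *)
Definition jump_kernel r x y : R := \sum_s r s * (sigma s x == y)%:R.

Lemma kmul_jump r A x y :
  kmul (jump_kernel r) A x y = \sum_s r s * A (sigma s x) y.
Proof.
rewrite /kmul /jump_kernel; under eq_bigr do rewrite mulr_suml.
rewrite exchange_big/=; apply: eq_bigr => s _.
rewrite (bigD1 (sigma s x))//= eqxx mulr1 big1 ?addr0// => z.
by rewrite eq_sym => /negbTE ->; rewrite mulr0 mul0r.
Qed.

Lemma jump_kernelC r r' :
  kmul (jump_kernel r) (jump_kernel r') = kmul (jump_kernel r') (jump_kernel r).
Proof.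
apply/funext => x; apply/funext => y; rewrite !kmul_jump /jump_kernel.
under eq_bigr do rewrite mulr_sumr.
rewrite exchange_big/=; apply: eq_bigr => s _; rewrite mulr_sumr.
by apply: eq_bigr => i _; rewrite sigmaC mulrCA.
Qed.

Lemma jump_kernel_ge0 r x y : (forall s, 0 <= r s) -> 0 <= jump_kernel r x y.
Proof. by move=> r0; apply: sumr_ge0 => s _; rewrite mulr_ge0. Qed.

Lemma generatorE r : generator sigma r =
  fun x y => jump_kernel r x y + (- \sum_s r s) * kid x y.
Proof.
apply/funext => x; apply/funext => y; rewrite /generator /jump_kernel /kid.
by rewrite mulNr mulr_suml -sumrB; apply: eq_bigr => s _; rewrite mulrBr.
Qed.

Lemma kapp_generator r f x :
  kapp (generator sigma r) f x = \sum_s r s * (f (sigma s x) - f x).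
Proof.
rewrite /kapp /generator; under eq_bigr do rewrite mulr_suml.
rewrite exchange_big/=; apply: eq_bigr => s _.
under eq_bigr do rewrite -mulrA mulrBl.
rewrite -mulr_sumr sumrB; congr (_ * (_ - _)).
  rewrite (bigD1 (sigma s x))//= eqxx mul1r big1 ?addr0// => z.
  by rewrite eq_sym => /negbTE ->; rewrite mul0r.
rewrite (bigD1 x)//= eqxx mul1r big1 ?addr0// => z.
by rewrite eq_sym => /negbTE ->; rewrite mul0r.
Qed.

Lemma generator_sum0 r x : \sum_y generator sigma r x y = 0.
Proof.
transitivity (kapp (generator sigma r) (fun=> 1) x).
  by apply: eq_bigr => y _; rewrite mulr1.
by rewrite kapp_generator big1// => s _; rewrite subrr mulr0.
Qed.

(** The diagonal part is a multiple of the identity, so it commutes with the jumps and splits off as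
    a scalar factor. *)
Lemma semigroup_generator r t x y : semigroup (generator sigma r) t x y =
  expR (- (t * \sum_s r s)) * semigroup (jump_kernel r) t x y.
Proof.
rewrite generatorE semigroupD.
  by rewrite semigroup_scalar kmulZr kmul1 mulrN.
by rewrite kmulZr kmulZl k1mul kmul1.
Qed.

Lemma semigroup_generator_ge0 r t x y : 0 <= t -> (forall s, 0 <= r s) ->
  0 <= semigroup (generator sigma r) t x y.
Proof.
move=> t0 r0; rewrite semigroup_generator mulr_ge0 ?expR_ge0//.
by apply: semigroup_ge0 => // ? ?; exact: jump_kernel_ge0.
Qed.

Lemma semigroup_generator_sum1 r t x :
  \sum_y semigroup (generator sigma r) t x y = 1.
Proof. by apply: semigroup_sum1 => {}x; exact: generator_sum0. Qed.

Lemma kapp_cst r t a x : kapp (semigroup (generator sigma r) t) (fun=> a) x = a.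
Proof. by rewrite /kapp -mulr_suml semigroup_generator_sum1 mul1r. Qed.

Lemma jump_generatorC r r' :
  kmul (jump_kernel r) (generator sigma r') = kmul (generator sigma r') (jump_kernel r).
Proof.
by rewrite generatorE kmulDr kmulDl jump_kernelC kmulZr kmulZl k1mul kmul1.
Qed.

(** A single jump is the jump kernel of a Dirac rate, and all jump kernels commute with the
    generator. *)
Lemma kapp_jump r t f s x : kapp (semigroup (generator sigma r) t) f (sigma s x) =
  kapp (semigroup (generator sigma r) t) (f \o sigma s) x.
Proof.
pose d i : R := (i == s)%:R.
have dE (g : T -> R) y : kapp (jump_kernel d) g y = g (sigma s y).
  rewrite /kapp /jump_kernel; under eq_bigr do rewrite mulr_suml.
  rewrite exchange_big/= (bigD1 s)//= [X in _ + X]big1 => [|i /negbTE si]; last first.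
    by rewrite big1// => z _; rewrite /d si !mul0r.
  rewrite addr0 (bigD1 (sigma s y))//= /d !eqxx !mul1r big1 ?addr0// => z.
  by rewrite eq_sym => /negbTE ->; rewrite mulr0 mul0r.
rewrite -dE -kapp_kmul semigroup_comm ?jump_generatorC// kapp_kmul.
by congr (kapp _ _ _); apply/funext => y; rewrite dE.
Qed.

Lemma kapp_le r t f g x : 0 <= t -> (forall s, 0 <= r s) ->
  (forall y, f y <= g y) ->
  kapp (semigroup (generator sigma r) t) f x <= kapp (semigroup (generator sigma r) t) g x.
Proof.
move=> t0 r0 fg; apply: ler_sum => y _.
by rewrite ler_wpM2l// semigroup_generator_ge0.
Qed.

Lemma kapp_gt0 r t f x : 0 <= t -> (forall s, 0 <= r s) ->
  (forall y, 0 < f y) -> 0 < kapp (semigroup (generator sigma r) t) f x.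
Proof.
move=> t0 r0 f0; set P := semigroup _ _.
have Pf y : 0 <= P x y * f y by rewrite mulr_ge0 ?semigroup_generator_ge0// ltW.
rewrite lt_neqAle sumr_ge0 ?andbT//; apply/eqP => /esym/psumr_eq0P H.
have P0 y : P x y = 0.
  have /eqP := H (fun y _ => Pf y) y isT.
  by rewrite mulf_eq0 (gt_eqF (f0 y)) orbF => /eqP.
have := semigroup_generator_sum1 r t x; rewrite big1 => [/eqP|y _]; last exact: P0.
by rewrite eq_sym oner_eq0.
Qed.

(* Tilting the rates by [expR (y s)]: by induction on the number of jumps, the
   tangent-line bound [expR v >= expR c * (1 + v - c)] summed over all words. *)
Lemma gen_pow_tilt (a y : J -> R) n c x z : (forall s, 0 <= a s) ->
  expR c * ((1 - c) * gen_pow (jump_kernel a) n x z +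
    n%:R * kmul (jump_kernel (fun s => a s * y s)) (gen_pow (jump_kernel a) n.-1) x z)
  <= gen_pow (jump_kernel (fun s => a s * expR (y s))) n x z.
Proof.
move=> a0; elim: n c x => [|n IH] c x.
  rewrite mul0r addr0 !gen_pow0 /kid mulrA ler_piMl//.
  rewrite -[leRHS](@expRxMexpNx_1 _ c) ler_wpM2l ?expR_ge0//.
  by have := expR_ge1Dx (- c).
rewrite [n.+1.-1]/= (gen_powS (jump_kernel a))
  (gen_powS (jump_kernel (fun s => a s * expR (y s))))
  (kmul_jump (fun s => a s * expR (y s))).
set Y := jump_kernel (fun s => a s * y s); set B := jump_kernel a.
(* The weight of the first jump [s] is charged to the constant: the induction hypothesis is used
   with [c - y s]. *)
apply: le_trans (_ : \sum_s a s * expR (y s) * (expR (c - y s) *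
   ((1 - (c - y s)) * gen_pow B n (sigma s x) z + n%:R * kmul Y (gen_pow B n.-1) (sigma s x) z)) <= _); last first.
  apply: ler_sum => s _; rewrite ler_wpM2l ?mulr_ge0 ?expR_ge0//.
under eq_bigr => s _.
  have -> : a s * expR (y s) * (expR (c - y s) *
   ((1 - (c - y s)) * gen_pow B n (sigma s x) z + n%:R * kmul Y (gen_pow B n.-1) (sigma s x) z)) =
   expR c * ((1 - c) * (a s * gen_pow B n (sigma s x) z) + (a s * y s) * gen_pow B n (sigma s x) z
     + n%:R * (a s * kmul Y (gen_pow B n.-1) (sigma s x) z)).
    rewrite expRD expRN; field; exact: lt0r_neq0 (expR_gt0 _).
  over.
rewrite -mulr_sumr ler_wpM2l ?expR_ge0// 2!big_split/= -!mulr_sumr.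
rewrite -!kmul_jump -/B -/Y -addrA lerD2l -[n.+1]add1n natrD mulrDl mul1r lerD2l.
case: n {IH} => [|n]; first by rewrite !mul0r.
by rewrite kmulA jump_kernelC -kmulA.
Qed.

(** [gen_pow_tilt] is summed against the exponential weights. The factor [n] cancels against the
    factorial and shifts the index by one, which produces the factor [t] and explains [N.+1] terms
    in [u] against [N] in [v]. *)
Lemma semigroup_tilt (a y : J -> R) t c x z : (forall s, 0 <= a s) -> 0 <= t ->
  expR c * ((1 - c) * semigroup (jump_kernel a) t x z +
    t * kmul (jump_kernel (fun s => a s * y s)) (semigroup (jump_kernel a) t) x z)
  <= semigroup (jump_kernel (fun s => a s * expR (y s))) t x z.
Proof.
move=> a0 t0; set Y := jump_kernel (fun s => a s * y s); set B := jump_kernel a.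
set B' := jump_kernel (fun s => a s * expR (y s)).
pose u N := \sum_(0 <= n < N) t ^+ n / n`!%:R * gen_pow B n x z.
pose u' N := \sum_(0 <= n < N) t ^+ n / n`!%:R * gen_pow B' n x z.
pose v N := \sum_(0 <= n < N) t ^+ n / n`!%:R * kmul Y (gen_pow B n) x z.
have cB : u N.+1 @[N --> \oo] --> semigroup B t x z.
  by rewrite (cvg_shiftS u); exact: cvg_semigroup.
have cB' : u' N.+1 @[N --> \oo] --> semigroup B' t x z.
  by rewrite (cvg_shiftS u'); exact: cvg_semigroup.
have cl : expR c * ((1 - c) * u N.+1 + t * v N) @[N --> \oo] -->
    expR c * ((1 - c) * semigroup B t x z + t * kmul Y (semigroup B t) x z).
  apply: cvgM; first exact: cvg_cst.
  apply: cvgD; first exact: cvgM (cvg_cst _) cB.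
  by apply: cvgM (cvg_cst _) _; exact: cvg_kmul_semigroup.
apply: (ler_cvg_to cl cB'); apply: nearW => N.
apply: le_trans (_ : \sum_(0 <= n < N.+1) t ^+ n / n`!%:R *
   (expR c * ((1 - c) * gen_pow B n x z + n%:R * kmul Y (gen_pow B n.-1) x z)) <= _); last first.
  apply: ler_sum => n _; rewrite ler_wpM2l ?gen_pow_tilt// divr_ge0// exprn_ge0//.
rewrite le_eqVlt; apply/orP; left; apply/eqP; rewrite /u /v.
have -> : t * \sum_(0 <= n < N) t ^+ n / n`!%:R * kmul Y (gen_pow B n) x z =
   \sum_(0 <= n < N.+1) t ^+ n / n`!%:R * (n%:R * kmul Y (gen_pow B n.-1) x z).
  rewrite big_nat_recl//= mul0r mulr0 add0r mulr_sumr; apply: eq_bigr => n _.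
  rewrite factS natrM exprS; field.
  by rewrite nat1r !pnatr_eq0 -lt0n fact_gt0.
rewrite mulr_sumr -big_split/= mulr_sumr; apply: eq_bigr => n _; ring.
Qed.

End Jumps.

(** * Relative entropy of a Doob transform *)

Lemma mvt_le (R : realType) (f df : R -> R) (tau B : R) : 0 <= tau ->
  (forall t, 0 <= t <= tau -> is_derive t 1 f (df t)) ->
  (forall t, 0 <= t <= tau -> df t <= B) -> f tau <= f 0 + tau * B.
Proof.
move=> tau0 fd dB.
have [|//|c cI E] := @MVT_segment _ f df 0 tau tau0.
- by move=> x; rewrite in_itv/= => /andP[/ltW x0 /ltW xt]; apply: fd; rewrite x0.
- apply: derivable_within_continuous => x; rewrite in_itv/= => xI.
  by have [] := fd _ xI.
rewrite -lerBlDl E subr0 mulrC ler_wpM2l// dB//.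
Qed.

Section RelativeEntropy.
Context {R : realType} {T J : finType}.
Variable sigma : J -> T -> T.
Hypothesis sigmaC : forall i j x, sigma i (sigma j x) = sigma j (sigma i x).
Implicit Types (r a b : J -> R) (F G : T -> R) (t tau : R).

(** Logarithmic form of [semigroup_tilt] with [y] the logarithm of the ratio of rates, after the
    scalar factors of both semigroups are restored. *)
Lemma semigroup_generator_tilt a b t x z :
  let P := semigroup (generator sigma a) t in
  let S := semigroup (generator sigma b) t in
  (forall s, 0 < a s) -> (forall s, 0 < b s) -> 0 <= t -> 0 < P x z ->
  0 < S x z /\
  P x z * ln (P x z / S x z) <= t * (\sum_s b s - \sum_s a s) * P x z -
    t * \sum_s a s * ln (b s / a s) * P (sigma s x) z.
Proof.
move=> P S a0 b0 t0; rewrite /P /S !semigroup_generator.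
set P0 := semigroup (jump_kernel sigma a) t x z.
set S0 := semigroup (jump_kernel sigma b) t x z.
rewrite pmulr_rgt0 ?expR_gt0// => P00.
pose y s := ln (b s / a s).
have bE : (fun s => a s * expR (y s)) = b.
  apply/funext => s; rewrite /y lnK ?posrE ?divr_gt0//.
  by rewrite mulrC divfK// gt_eqF.
pose K := kmul (jump_kernel sigma (fun s => a s * y s)) (semigroup (jump_kernel sigma a) t) x z.
(* With this value the bracket of the tilting bound is [P0]. It is the mean, over the paths from [x]
   to [z], of the sum of [y] over their jumps. *)
pose c := t * K / P0.
have := @semigroup_tilt _ _ _ _ sigmaC a y t c x z (fun s => ltW (a0 s)) t0.
rewrite bE -/P0 -/S0 -/K.
have -> : (1 - c) * P0 + t * K = P0.
  by rewrite /c; field; rewrite gt_eqF.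
move=> H; have S00 : 0 < S0 by apply: lt_le_trans H; rewrite mulr_gt0 ?expR_gt0.
split; first by rewrite mulr_gt0 ?expR_gt0.
set ea := expR (- (t * \sum_s a s)).
have -> : t * (\sum_s a s * ln (b s / a s) *
    semigroup (generator sigma a) t (sigma s x) z) = ea * P0 * c.
  have -> : ea * P0 * c = t * (ea * K) by rewrite /c; field; rewrite gt_eqF.
  congr (_ * _); rewrite /K kmul_jump mulr_sumr; apply: eq_bigr => s _.
  by rewrite semigroup_generator mulrCA.
rewrite [_ * (ea * P0) in leRHS]mulrC -mulrBr ler_wpM2l//.
  by rewrite mulr_ge0 ?expR_ge0 ?ltW.
rewrite -ler_expR lnK ?posrE ?divr_gt0 ?mulr_gt0 ?expR_gt0//.
rewrite ler_pdivrMr ?mulr_gt0 ?expR_gt0//.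
have -> : expR (t * (\sum_s b s - \sum_s a s) - c) * (expR (- (t * \sum_s b s)) * S0) =
   expR (- (t * \sum_s a s)) * (expR (- c) * S0).
  by rewrite !mulrA -!expRD; congr (expR _ * _); ring.
rewrite ler_wpM2l ?expR_ge0// expRN mulrC ler_pdivlMr ?expR_gt0//.
by rewrite mulrC.
Qed.

(** The pointwise bound of [semigroup_generator_tilt] is averaged against [F]; the kernels started
    at [sigma s x] then become the values of [kapp P F] there. *)
Lemma tilted_relent a b F t x :
  let P := semigroup (generator sigma a) t in
  let S := semigroup (generator sigma b) t in
  (forall s, 0 < a s) -> (forall s, 0 < b s) -> 0 <= t ->
  (forall y, 0 < P x y) -> (forall y, 0 < F y) ->
  \sum_y P x y * F y * ln (P x y * F y / S x y) <=
    kapp P (fun y => F y * ln (F y)) x + t * (\sum_s b s - \sum_s a s) * kapp P F x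
    - t * \sum_s a s * ln (b s / a s) * kapp P F (sigma s x).
Proof.
move=> P S a0 b0 t0 P0 F0.
have -> : kapp P (fun y => F y * ln (F y)) x +
    t * (\sum_s b s - \sum_s a s) * kapp P F x
    - t * \sum_s a s * ln (b s / a s) * kapp P F (sigma s x) =
  \sum_y (P x y * (F y * ln (F y)) + F y * (t * (\sum_s b s - \sum_s a s) * P x y -
    t * \sum_s a s * ln (b s / a s) * P (sigma s x) y)).
  rewrite /kapp; under [in RHS]eq_bigr do rewrite mulrBr addrA.
  rewrite sumrB big_split/=; congr (_ + _ - _).
    by rewrite mulr_sumr; apply: eq_bigr => y _; ring.
  rewrite mulr_sumr; under [in LHS]eq_bigr do rewrite !mulr_sumr.
  rewrite exchange_big/=; apply: eq_bigr => y _; rewrite !mulr_sumr.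
  by apply: eq_bigr => s _; ring.
apply: ler_sum => y _.
have [S0 PS] := @semigroup_generator_tilt a b t x y a0 b0 t0 (P0 y).
rewrite [_ * F y / _]mulrAC lnM ?posrE ?divr_gt0//.
have -> : P x y * F y * (ln (P x y / S x y) + ln (F y)) =
  P x y * (F y * ln (F y)) + F y * (P x y * ln (P x y / S x y)) by ring.
by rewrite lerD2l ler_wpM2l// ltW.
Qed.

(** For positive arguments this is [b * phi (a / b)] with [a = g'] and [b = f' * g / f]: the cost of
    a jump that multiplies [g] by [g' / g] and [f] by [f' / f]. *)
Definition jump_div (g g' f f' : R) : R :=
  g' * (ln g' - ln f' - ln g + ln f) - g' + f' * g / f.

(** The second summand is the time derivative of [g * (ln g - ln f)] when [g] and [f] solve the
    backward equation. The identity holds jump by jump. *)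
Lemma generator_relent r (f g : T -> R) x :
  (forall y, 0 < f y) -> (forall y, 0 < g y) ->
  let Q := generator sigma r in
  kapp Q (fun y => g y * (ln (g y) - ln (f y))) x +
   (- kapp Q g x * (ln (g x) - ln (f x)) +
    g x * ((g x)^-1 * (- kapp Q g x) - (f x)^-1 * (- kapp Q f x))) =
  \sum_s r s * jump_div (g x) (g (sigma s x)) (f x) (f (sigma s x)).
Proof.
move=> f0 g0 Q; rewrite /Q !kapp_generator -!sumrN !mulr_sumr -sumrN mulr_suml.
rewrite -big_split/= mulr_sumr -!big_split/=.
apply: eq_bigr => s _; rewrite /jump_div; field.
by rewrite !gt_eqF.
Qed.

(** Used twice in [relent_growth]: with [F] replaced by 1 it gives the first derivative of the
    entropy, and with [G = F \o sigma s] the second one. *)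
Lemma is_derive_relent r F G tau t z :
  let P := fun t => semigroup (generator sigma r) t in
  (forall s, 0 <= r s) -> (forall x, 0 < F x) -> (forall x, 0 < G x) ->
  t <= tau ->
  let g := kapp (P (tau - t)) G in let f := kapp (P (tau - t)) F in
  is_derive t 1
    (fun t => kapp (P t) (fun x => kapp (P (tau - t)) G x *
       (ln (kapp (P (tau - t)) G x) - ln (kapp (P (tau - t)) F x))) z)
    (kapp (P t) (fun x => \sum_s r s *
       jump_div (g x) (g (sigma s x)) (f x) (f (sigma s x))) z).
Proof.
move=> P r0 F0 G0 ttau g f.
set Q := generator sigma r.
have g0 x : 0 < g x by apply: kapp_gt0 => //; rewrite subr_ge0.
have f0 x : 0 < f x by apply: kapp_gt0 => //; rewrite subr_ge0.
pose psi x := g x * (ln (g x) - ln (f x)).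
pose dpsi x := - kapp Q g x * (ln (g x) - ln (f x)) +
  g x * ((g x)^-1 * (- kapp Q g x) - (f x)^-1 * (- kapp Q f x)).
have -> : kapp (P t) (fun x => \sum_s r s *
     jump_div (g x) (g (sigma s x)) (f x) (f (sigma s x))) z =
   \sum_x (kmul Q (P t) z x * psi x + P t z x * dpsi x).
  rewrite big_split/= -/(kapp _ _ _) /P semigroup_comm// -/(P t).
  rewrite -[X in _ = X + _]/(kapp _ psi z) kapp_kmul /kapp -big_split/=.
  apply: eq_bigr => x _; rewrite -mulrDr; congr (_ * _).
  by rewrite -generator_relent.
have dg (H : T -> R) x : is_derive t 1 (fun t => kapp (P (tau - t)) H x) (- kapp Q (kapp (P (tau - t)) H) x).
  exact: (@is_derive_reflect _ (fun t => kapp (P t) H x) _ _ _ (@is_derive_kapp _ _ Q H (tau - t) x)).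
apply: (@is_derive_fsum _ _ (fun x t => P t z x * (kapp (P (tau - t)) G x *
       (ln (kapp (P (tau - t)) G x) - ln (kapp (P (tau - t)) F x))))) => x.
apply: (@is_derive_mul _ (fun t => P t z x)); first exact: is_derive_semigroup.
rewrite /dpsi; apply: (@is_derive_mul _ (fun t => kapp (P (tau - t)) G x)).
apply: (@is_deriveB _ _ _ (fun t => ln (kapp (P (tau - t)) G x)) (fun t => ln (kapp (P (tau - t)) F x))).
- apply: (@is_derive1_comp _ (@ln R) (fun t => kapp (P (tau - t)) G x)).
  exact: is_derive1_ln.
- apply: (@is_derive1_comp _ (@ln R) (fun t => kapp (P (tau - t)) F x)).
  exact: is_derive1_ln.
Qed.

(** Each of the two ratios inside the logarithm contributes at most [ln rho], and the term [- g'] is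
    dropped. *)
Lemma jump_div_le rho g g' f f' : 0 < g -> 0 < g' -> 0 < f -> 0 < f' ->
  g' <= rho * g -> f <= rho * f' ->
  jump_div g g' f f' <= 2 * ln rho * g' + f' * g / f.
Proof.
move=> g0 g'0 f0 f'0 gg ff; have rho0 : 0 < rho.
  by rewrite -(pmulr_lgt0 _ g0) (lt_le_trans g'0).
have Hg : ln g' <= ln rho + ln g.
  by rewrite -lnM ?posrE// ler_ln ?posrE// mulr_gt0.
have Hf : ln f <= ln rho + ln f'.
  by rewrite -lnM ?posrE// ler_ln ?posrE// mulr_gt0.
rewrite /jump_div lerD2r.
have H : g' * (ln g' - ln f' - ln g + ln f) <= g' * (2 * ln rho).
  by rewrite ler_wpM2l ?(ltW g'0)//; lra.
by rewrite [leRHS]mulrC; apply: le_trans H; rewrite gerBl ltW.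
Qed.

(** * Growth of the entropy to second order in time *)

Section SecondOrder.
Variables (r : J -> R) (F : T -> R) (L rho : R).
Hypothesis r0 : forall s, 0 <= r s.
Hypothesis F0 : forall x, 0 < F x.
Hypothesis FL : forall x, \sum_s r s * F (sigma s x) <= L * F x.
Hypothesis Frho : forall s x, F (sigma s x) <= rho * F x.
Hypothesis Frho' : forall s x, F x <= rho * F (sigma s x).

Let P t := semigroup (generator sigma r) t.

Lemma kappZ t (a : R) G x : kapp (P t) (fun y => a * G y) x = a * kapp (P t) G x.
Proof. by rewrite /kapp mulr_sumr; apply: eq_bigr => y _; rewrite mulrCA. Qed.

Lemma kapp_sum (I : finType) t (w : I -> R) (G : I -> T -> R) x :
  kapp (P t) (fun y => \sum_i w i * G i y) x = \sum_i w i * kapp (P t) (G i) x.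
Proof.
rewrite /kapp; under eq_bigr do rewrite mulr_sumr.
rewrite exchange_big/=; apply: eq_bigr => i _; rewrite mulr_sumr.
by apply: eq_bigr => y _; rewrite mulrCA.
Qed.

Lemma kapp_semigroup s t G x : kapp (P s) (kapp (P t) G) x = kapp (P (s + t)) G x.
Proof. by rewrite -kapp_kmul /P semigroup_add. Qed.

(** The hypotheses on [F] compare it with its composites with jumps. Since jumps commute with the
    positive operators [P t], they pass to [kapp (P t) F] with the same constants; the next two
    lemmas do this for the Harnack bounds. *)
Lemma kapp_rate t x : 0 <= t ->
  \sum_s r s * kapp (P t) F (sigma s x) <= L * kapp (P t) F x.
Proof.
move=> t0; rewrite -kappZ; under eq_bigr do rewrite kapp_jump//.
by rewrite -kapp_sum; apply: kapp_le => // y; exact: FL.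
Qed.

Lemma kapp_harnack t s x : 0 <= t ->
  kapp (P t) F (sigma s x) <= rho * kapp (P t) F x.
Proof.
by move=> t0; rewrite -kappZ kapp_jump//; apply: kapp_le => // y; exact: Frho.
Qed.

Lemma kapp_harnack' t s x : 0 <= t ->
  kapp (P t) F x <= rho * kapp (P t) F (sigma s x).
Proof.
by move=> t0; rewrite kapp_jump// -kappZ; apply: kapp_le => // y; exact: Frho'.
Qed.

Lemma second_order_le (f : T -> R) x : (forall y, 0 < f y) -> 0 <= L -> 1 <= rho ->
  (forall y, \sum_s r s * f (sigma s y) <= L * f y) ->
  (forall s y, f (sigma s y) <= rho * f y) ->
  (forall s y, f y <= rho * f (sigma s y)) ->
  \sum_s r s * (\sum_i r i * jump_div (f (sigma s x)) (f (sigma s (sigma i x))) (f x) (f (sigma i x)))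
   <= L ^+ 2 * (2 * ln rho + 1) * f x.
Proof.
move=> f0 L0 rho1 fL frho frho'.
apply: le_trans (_ : \sum_s r s * (\sum_i r i * (2 * ln rho * f (sigma s (sigma i x)) +
     f (sigma i x) * f (sigma s x) / f x)) <= _).
  apply: ler_sum => s _; rewrite ler_wpM2l//; apply: ler_sum => i _.
  by rewrite ler_wpM2l// jump_div_le// sigmaC frho.
have ln0 : 0 <= 2 * ln rho by rewrite mulr_ge0// ln_ge0.
under eq_bigr => s _.
  under eq_bigr do rewrite mulrDr.
  rewrite big_split/= mulrDr. over.
rewrite big_split/= mulrDr mulr1 mulrDl; apply: lerD.
  (* The logarithmic part is a sum over pairs of jumps: the rate bound is used once for each jump of
     the pair. *)
  under eq_bigr do rewrite mulr_sumr.
  rewrite exchange_big/=.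
  apply: le_trans (_ : \sum_i 2 * ln rho * (r i * (L * f (sigma i x))) <= _).
    apply: ler_sum => i _.
    rewrite [leLHS](_ : _ = 2 * ln rho * (r i * \sum_s r s * f (sigma s (sigma i x)))); last first.
      by rewrite !mulr_sumr; apply: eq_bigr => s _; ring.
    by rewrite !ler_wpM2l.
  rewrite [leLHS](_ : _ = 2 * ln rho * (L * \sum_s r s * f (sigma s x))); last first.
    by rewrite !mulr_sumr; apply: eq_bigr => i _; ring.
  rewrite [leRHS](_ : _ = 2 * ln rho * (L * (L * f x))); last by ring.
  by rewrite !ler_wpM2l.
(* The remaining double sum factorizes into a square, to which the rate bound applies directly. *)
rewrite [leLHS](_ : _ = (\sum_s r s * f (sigma s x)) ^+ 2 / f x); last first.
  rewrite expr2 -mulrA mulr_suml; apply: eq_bigr => s _.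
  rewrite mulr_suml !mulr_sumr; apply: eq_bigr => i _; ring.
rewrite ler_pdivrMr// [leRHS](_ : _ = (L * f x) ^+ 2); last by ring.
rewrite ler_sqr ?nnegrE; first exact: fL.
  by apply: sumr_ge0 => s _; rewrite mulr_ge0// ltW.
by rewrite mulr_ge0// ltW.
Qed.

Lemma relent_growth tau z : 0 <= tau -> 0 <= L -> 1 <= rho ->
  kapp (P tau) F z = 1 ->
  kapp (P tau) (fun x => F x * ln (F x)) z <=
    tau * (\sum_s r s * (kapp (P tau) F (sigma s z) * ln (kapp (P tau) F (sigma s z))
                           - kapp (P tau) F (sigma s z) + 1)) +
    tau ^+ 2 * (L ^+ 2 * (2 * ln rho + 1)).
Proof.
move=> tau0 L0 rho1 Fz1.
pose Ft t := kapp (P (tau - t)) F; pose Bd := L ^+ 2 * (2 * ln rho + 1).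
have Ft0 t x : t <= tau -> 0 < Ft t x by move=> tt; apply: kapp_gt0; rewrite ?subr_ge0.
have PFt t x : kapp (P t) (Ft t) x = kapp (P tau) F x.
  by rewrite kapp_semigroup addrC subrK.
have FtJ t s x : Ft t (sigma s x) = kapp (P (tau - t)) (F \o sigma s) x.
  by rewrite /Ft kapp_jump.
have P0 : P 0 = kid by rewrite /P semigroup0.
(* Up to the constant [cst0], [g] is the derivative of the entropy [h] below; its summands again
   have the form treated by [is_derive_relent]. *)
pose g t := \sum_s r s * kapp (P t) (fun x => Ft t (sigma s x) *
  (ln (Ft t (sigma s x)) - ln (Ft t x))) z.
pose dg t := \sum_s r s * kapp (P t) (fun x => \sum_i r i * jump_div
  (Ft t (sigma s x)) (Ft t (sigma s (sigma i x))) (Ft t x) (Ft t (sigma i x))) z.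
have gd t : 0 <= t <= tau -> is_derive t 1 g (dg t).
  move=> /andP[t0 tt]; apply: is_derive_fsum => s.
  have := @is_derive_relent r F (F \o sigma s) tau t z r0 F0 (fun x => F0 _) tt.
  have -> : (fun t => kapp (semigroup (generator sigma r) t)
    (fun x => kapp (semigroup (generator sigma r) (tau - t)) (F \o sigma s) x *
      (ln (kapp (semigroup (generator sigma r) (tau - t)) (F \o sigma s) x) -
       ln (kapp (semigroup (generator sigma r) (tau - t)) F x))) z) =
    (fun t => kapp (P t) (fun x => Ft t (sigma s x) * (ln (Ft t (sigma s x)) - ln (Ft t x))) z).
    by apply/funext => u; congr (kapp _ _ _); apply/funext => x; rewrite FtJ.
  rewrite /= => D.
  have := @is_derive_mul _ (fun=> r s) _ _ _ _ (is_derive_cst _ _ _) D.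
  rewrite mul0r add0r.
  have <- : (fun x => \sum_i r i * jump_div
     (Ft t (sigma s x)) (Ft t (sigma s (sigma i x))) (Ft t x) (Ft t (sigma i x))) =
    (fun x => \sum_s0 r s0 * jump_div (kapp (semigroup (generator sigma r) (tau - t)) (F \o sigma s) x)
      (kapp (semigroup (generator sigma r) (tau - t)) (F \o sigma s) (sigma s0 x))
      (kapp (semigroup (generator sigma r) (tau - t)) F x)
      (kapp (semigroup (generator sigma r) (tau - t)) F (sigma s0 x))).
    apply/funext => x; apply: eq_bigr => i _.
    by rewrite (FtJ t s x) (FtJ t s (sigma i x)).
  exact.
have dgB t : 0 <= t <= tau -> dg t <= Bd.
  (* [Ft t] has mean 1 under [P t] at [z], so a pointwise bound by [Bd * Ft t] integrates to
     [Bd]. *)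
  move=> /andP[t0 tt]; rewrite /dg -kapp_sum -[leRHS]mulr1 -Fz1 -(PFt t) -kappZ.
  apply: kapp_le => // x; apply: second_order_le => //.
  - by move=> y; exact: Ft0.
  - by move=> y; apply: kapp_rate; rewrite subr_ge0.
  - by move=> s y; apply: kapp_harnack; rewrite subr_ge0.
  - by move=> s y; apply: kapp_harnack'; rewrite subr_ge0.
have Bd0 : 0 <= Bd.
  by rewrite mulr_ge0 ?exprn_ge0// addr_ge0// mulr_ge0// ln_ge0.
have gB t : 0 <= t <= tau -> g t <= g 0 + tau * Bd.
  move=> /andP[t0 tt]; apply: le_trans (_ : g 0 + t * Bd <= _).
    apply: mvt_le => // u /andP[u0 ut]; first by apply: gd; rewrite u0 (le_trans ut).
    by apply: dgB; rewrite u0 (le_trans ut).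
  by rewrite lerD2l ler_wpM2r.
pose h t := kapp (P t) (fun x => Ft t x * (ln (Ft t x) - ln 1)) z.
(* The linear part of the derivative is constant, because the mean of [Ft t] under [P t] does not
   depend on [t]. *)
pose cst0 := \sum_s r s * (kapp (P tau) F (sigma s z) - 1).
have hd t : 0 <= t <= tau -> is_derive t 1 h (g t - cst0).
  move=> /andP[t0 tt].
  have := @is_derive_relent r (fun=> 1) F tau t z r0 (fun=> ltr01) F0 tt.
  have -> : (fun t => kapp (semigroup (generator sigma r) t)
    (fun x => kapp (semigroup (generator sigma r) (tau - t)) F x *
      (ln (kapp (semigroup (generator sigma r) (tau - t)) F x) -
       ln (kapp (semigroup (generator sigma r) (tau - t)) (fun=> 1) x))) z) = h.
    by apply/funext => u; congr (kapp _ _ _); apply/funext => x; rewrite kapp_cst.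
  have -> : g t - cst0 = kapp (P t) (fun x => \sum_s r s * jump_div (Ft t x) (Ft t (sigma s x)) 1 1) z.
    rewrite kapp_sum /g /cst0 -sumrB; apply: eq_bigr => s _; rewrite -mulrBr; congr (_ * _).
    have -> : kapp (P tau) F (sigma s z) - 1 = kapp (P t) (fun x => Ft t (sigma s x) - Ft t x) z.
      rewrite -{1}(PFt t) -Fz1 -(PFt t) kapp_jump//.
      by rewrite /kapp -sumrB; apply: eq_bigr => y _; rewrite mulrBr.
    rewrite /kapp -sumrB; apply: eq_bigr => y _; rewrite -mulrBr; congr (_ * _).
    by rewrite /jump_div ln1; field.
  rewrite /=; congr (is_derive _ _ _ _); congr (kapp _ _ _); apply/funext => x.
  by apply: eq_bigr => s _; rewrite !kapp_cst.
have := @mvt_le _ h _ tau (g 0 + tau * Bd - cst0) tau0 hd.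
have -> : h tau = kapp (P tau) (fun x => F x * ln (F x)) z.
  rewrite /h; congr (kapp _ _ _); apply/funext => x.
  by rewrite ln1 subr0 /Ft subrr P0 kapp1.
have -> : h 0 = 0 by rewrite /h P0 kapp1 /Ft subr0 Fz1 !ln1 subrr mulr0.
move=> H; apply: le_trans (H _) _.
  by move=> t tI; rewrite lerD2r gB.
rewrite add0r /Bd expr2 -[tau * tau * _]mulrA -mulrDr ler_wpM2l//.
rewrite addrAC lerD2r le_eqVlt; apply/orP; left; apply/eqP.
rewrite /g P0 /cst0 -sumrB; apply: eq_bigr => s _.
by rewrite kapp1 /Ft subr0 Fz1 ln1; ring.
Qed.

Lemma one_step_relent b tau z :
  let S := semigroup (generator sigma b) tau in
  (forall s, 0 < r s) -> (forall s, 0 < b s) -> 0 <= tau -> 0 <= L -> 1 <= rho ->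
  (forall y, 0 < P tau z y) -> kapp (P tau) F z = 1 ->
  \sum_y P tau z y * F y * ln (P tau z y * F y / S z y) <=
    tau * (\sum_s (r s * kapp (P tau) F (sigma s z) *
       ln (r s * kapp (P tau) F (sigma s z) / b s)
       - r s * kapp (P tau) F (sigma s z) + b s))
    + tau ^+ 2 * (L ^+ 2 * (2 * ln rho + 1)).
Proof.
move=> S rp b0 tau0 L0 rho1 P0 Fz1.
apply: le_trans (@tilted_relent r b F tau z rp b0 tau0 P0 F0) _.
rewrite -/(P tau) Fz1 mulr1.
have := relent_growth tau0 L0 rho1 Fz1; set E := kapp _ (fun _ => _) z.
set err := tau ^+ 2 * _; set u := fun s => kapp (P tau) F (sigma s z) => H.
have u0 s : 0 < u s by apply: kapp_gt0.
(* Change of reference from the base rates [r] to [b]: the correction is exactly what the tilting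
   bound supplies. *)
have -> : \sum_s (r s * u s * ln (r s * u s / b s) - r s * u s + b s) =
  \sum_s r s * (u s * ln (u s) - u s + 1) + (\sum_s b s - \sum_s r s)
   - \sum_s r s * ln (b s / r s) * u s.
  rewrite -!sumrB -big_split/= -sumrB; apply: eq_bigr => s _.
  rewrite lnM ?posrE ?mulr_gt0 ?invr_gt0// lnM ?posrE// lnV ?posrE//.
  by rewrite ln_div ?posrE//; ring.
rewrite mulrBr mulrDr; move: H; rewrite /u; lra.
Qed.

End SecondOrder.
End RelativeEntropy.

(** * Harnack inequality on the torus *)

(** The binomial coefficient is a product of [j] ratios [(i + k) / k] with [k <= j <= i], each at
    least 2. *)
Lemma factD_ge i j : (j <= i)%N -> (2 ^ j * (j`! * i`!) <= (i + j)`!)%N.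
Proof.
elim: j => [|j IH] ji; first by rewrite addn0 fact0 !mul1n.
rewrite addnS factS expnS factS.
have -> : (2 * 2 ^ j * (j.+1 * j`! * i`!) = (2 * j.+1) * (2 ^ j * (j`! * i`!)))%N by ring.
apply: leq_mul; last by apply: IH; exact: ltnW.
by rewrite mul2n -addnn -addnS leq_add2r.
Qed.

Lemma sum_inv_fact_le3 (R : realType) n : \sum_(0 <= i < n) (i`!%:R^-1 : R) <= 3.
Proof.
(* The subtracted term pays for the next one, as consecutive inverse factorials at least halve from
   here on. *)
suff H k : \sum_(0 <= i < k.+2) (i`!%:R^-1 : R) <= 3 - k.+1`!%:R^-1.
  case: n => [|[|n]]; [by rewrite big_nil| |].
    by rewrite big_nat1 fact0 invr1 ler1n.
  by apply: le_trans (H n) _; rewrite gerBl invr_ge0.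
elim: k => [|k IH].
  by rewrite big_nat_recr//= big_nat1 fact0 (_ : 1`! = 1)%N// invr1; lra.
rewrite big_nat_recr//=; apply: le_trans (lerD IH (lexx _)) _.
have -> : k.+2`!%:R^-1 = k.+2%:R^-1 * k.+1`!%:R^-1 :> R by rewrite factS natrM invfM.
set A := k.+1`!%:R^-1; set B := k.+2%:R^-1.
have : 2 * (B * A) <= A; last by lra.
rewrite /A /B.
by rewrite mulrA ler_piMl ?invr_ge0// ler_pdivrMr// mul1r ler_nat.
Qed.

(* The terms with [n <= 2 j] are bounded by [2 j] times the series; the others
   are dominated, factorially, by its [j]-th term. *)
Lemma exp_series_harnack (R : realType) (b : nat -> R) (beta t l0 l1 : R) j :
  0 < t <= 1 -> (forall n, 0 <= b n) -> (forall n, b n.+1 <= beta) ->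
  beta / 2 ^+ j <= b j ->
  series (fun n => t ^+ n / n`!%:R * b n) @ \oo --> l0 ->
  series (fun n => t ^+ n / n`!%:R * b n.+1) @ \oo --> l1 ->
  t * l1 <= (2 * j%:R + 3) * l0.
Proof.
move=> /andP[t0 t1] b0 bbeta bj cl0 cl1.
pose a n := t ^+ n / n`!%:R * b n.
have a0 n : 0 <= a n by rewrite mulr_ge0// divr_ge0// exprn_ge0// ltW.
have beta0 : 0 <= beta by apply: le_trans (bbeta 0%N).
have ajl0 : a j <= l0.
  rewrite -(cvg_lim (@Rhausdorff R) cl0).
  apply: le_trans (_ : series a j.+1 <= _).
    by rewrite /series/= big_nat_recr//=; apply: ler_wpDl => //; exact: sumr_ge0.
  apply: nondecreasing_cvgn_le; last exact: (cvgP _ cl0).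
  by apply/nondecreasing_seqP => k; rewrite /series/= big_nat_recr//= ler_wpDr.
have step M : (j.+1 + M)%:R * a (j.+1 + M)%N <= 2 * j%:R * a (j.+1 + M)%N + a j * M`!%:R^-1.
  have [Mj|jM] := ltnP M j.
    apply: ler_wpDr; first by rewrite mulr_ge0// invr_ge0.
    by rewrite ler_wpM2r// -natrM ler_nat mul2n -addnn addSnnS leq_add2l.
  apply: ler_wpDl; first by rewrite mulr_ge0// mulr_ge0.
  (* [t <= 1] lowers the power of [t] to [j]; the factor [2 ^ j] gained in [factD_ge] then makes up
     for the one lost in the lower bound on [b j]. *)
  apply: le_trans (_ : t ^+ j * beta / (M + j)`!%:R <= _).
    rewrite /a addSn; set k := (j + M)%N; rewrite factS natrM.
    have -> : k.+1%:R * (t ^+ k.+1 / (k.+1%:R * k`!%:R) * b k.+1) =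
        t ^+ k.+1 * b k.+1 / k`!%:R.
      by field; rewrite nat1r !pnatr_eq0 -lt0n fact_gt0.
    rewrite addnC -/k ler_wpM2r ?invr_ge0//; apply: ler_pM => //.
      by rewrite exprn_ge0// ltW.
    by rewrite ler_wiXn2l ?(ltW t0)// /k leqW// leq_addr.
  apply: le_trans (_ : t ^+ j / j`!%:R * (beta / 2 ^+ j) / M`!%:R <= _); last first.
    by rewrite ler_wpM2r ?invr_ge0// ler_wpM2l// divr_ge0// exprn_ge0// ltW.
  have -> : t ^+ j / j`!%:R * (beta / 2 ^+ j) / M`!%:R = t ^+ j * beta / (2 ^ j * (j`! * M`!))%:R.
    rewrite !natrM natrX; field.
    by rewrite !pnatr_eq0 -!lt0n !fact_gt0 expf_neq0// pnatr_eq0.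
  rewrite ler_wpM2l//; first by rewrite mulr_ge0// exprn_ge0// ltW.
  rewrite lef_pV2 ?posrE ?ltr0n ?fact_gt0// ?ler_nat ?factD_ge//.
  by rewrite !muln_gt0 expn_gt0 !fact_gt0.
have main M : \sum_(0 <= n < j.+1 + M) n%:R * a n <=
    2 * j%:R * \sum_(0 <= n < j.+1 + M) a n + a j * \sum_(0 <= i < M) i`!%:R^-1.
  elim: M => [|M IH].
    rewrite addn0 big_nil mulr0 addr0 mulr_sumr !big_mkord; apply: ler_sum => n _.
    rewrite ler_wpM2r// -natrM ler_nat mul2n -addnn.
    by rewrite (leq_trans (_ : n <= j)%N) ?leq_addr// -ltnS.
  rewrite addnS (big_nat_recr (j.+1 + M))//= (big_nat_recr (j.+1 + M))//=.
  rewrite (big_nat_recr M)//= [leRHS](_ : _ = (2 * j%:R * \sum_(0 <= n < j.+1 + M) a n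
   + a j * \sum_(0 <= i < M) i`!%:R^-1) + (2 * j%:R * a (j.+1 + M)%N + a j * M`!%:R^-1)); last by ring.
  exact: lerD.
have cu : series a N.+1 @[N --> \oo] --> l0 by rewrite (cvg_shiftS (series a)).
(* [t * l1] is the sum of [n * a n]: the claim bounds the mean of the index under the weights
   [a]. *)
have cl : t * series (fun n => t ^+ n / n`!%:R * b n.+1) N @[N --> \oo] --> t * l1.
  exact: cvgM (cvg_cst _) cl1.
have cr : 2 * j%:R * series a N.+1 + 3 * a j @[N --> \oo] --> 2 * j%:R * l0 + 3 * a j.
  by apply: cvgD (cvg_cst _); exact: cvgM (cvg_cst _) cu.
apply: le_trans (_ : 2 * j%:R * l0 + 3 * a j <= _); last first.
  by rewrite [leRHS]mulrDl lerD2l ler_wpM2l.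
apply: (ler_cvg_to cl cr); exists j => // N jN.
have -> : t * series (fun n => t ^+ n / n`!%:R * b n.+1) N = \sum_(0 <= n < N.+1) n%:R * a n.
  rewrite big_nat_recl//= mul0r add0r /series/= mulr_sumr; apply: eq_bigr => n _.
  rewrite /a factS natrM exprS; field.
  by rewrite nat1r !pnatr_eq0 -lt0n fact_gt0.
have [M ->] : exists M, N.+1 = (j.+1 + M)%N by exists (N - j)%N; rewrite addSn subnKC.
apply: le_trans (main M) _; rewrite lerD2l mulrC ler_wpM2r//.
exact: sum_inv_fact_le3.
Qed.

Section KernelHarnack.
Context {R : realType} {T : finType}.
Variables (Q : T -> T -> R) (beta : R).
Hypothesis Q0 : forall x y, 0 <= Q x y.
Hypothesis Q1 : forall x, \sum_y Q x y <= 1.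
Hypothesis Qbeta : forall x y, Q x y <= beta.

(** A subaverage of entries bounded by [beta] keeps the bound. Powers start at one, since the
    identity may exceed [beta]. *)
Lemma gen_powS_le n x y : gen_pow Q n.+1 x y <= beta.
Proof.
elim: n x => [|n IH] x; first by rewrite gen_powS gen_pow0 kmul1.
have beta0 : 0 <= beta by exact: le_trans (Qbeta x y).
rewrite gen_powS; apply: le_trans (_ : (\sum_z Q x z) * beta <= _).
  by rewrite mulr_suml; apply: ler_sum => z _; rewrite ler_wpM2l.
by rewrite ler_piMl.
Qed.

(** Either [y] is never reached from [x] and both sides vanish, or it is reached in [j] jumps with
    enough mass for [exp_series_harnack]. *)
Lemma semigroup_harnack c t x y : 0 < t <= 1 ->
  (forall n, gen_pow Q n x y = 0) \/
  (exists2 j, beta / 2 ^+ j <= gen_pow Q j x y & 2 * j%:R + 3 <= c) ->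
  t * kmul Q (semigroup Q t) x y <= c * semigroup Q t x y.
Proof.
move=> tI; have t0 : 0 <= t by case/andP: tI => /ltW.
case=> [Z|[j bj jc]].
  have -> : kmul Q (semigroup Q t) x y = 0.
    rewrite -(cvg_lim (@Rhausdorff R) (@cvg_kmul_semigroup _ _ Q Q t x y)).
    apply: lim_near_cst => //; apply: nearW => N; rewrite /series/= big1// => n _.
    by rewrite -gen_powS Z mulr0.
  rewrite mulr0 [semigroup _ _ _ _](_ : _ = 0) ?mulr0//.
  apply: lim_near_cst => //; apply: nearW => N; rewrite /series/= big1// => n _.
  by rewrite Z mulr0.
apply: le_trans (_ : (2 * j%:R + 3) * semigroup Q t x y <= _).
  apply: (@exp_series_harnack _ (fun n => gen_pow Q n x y) beta t) => //.
  - by move=> n; exact: gen_pow_ge0.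
  - by move=> n; exact: gen_powS_le.
  - exact: cvg_semigroup.
  - exact: cvg_kmul_semigroup.
by rewrite ler_wpM2r// semigroup_ge0.
Qed.

End KernelHarnack.

Definition axis (b : walk) (d m : nat) : jumps b d m -> 'I_d :=
  match b return jumps b d m -> 'I_d with
  | NNRW => fun s => s.1
  | URW => fun s => s.1
  end.

(** * Axes of the torus and the heat kernel of the base walk *)

Section Torus.
Context {R : realType}.
Variables (b : walk) (d m : nat).
Hypothesis m1 : (1 < m)%N.
Local Notation T := (torus d m).
Local Notation J := (jumps b d m).
Local Notation sigma := (@jump b d m).
Local Notation lam := (jump_rate R b m).

(** Jumps are translations; commutation and inverses are read off from the displacement
    [sigma s 0]. *)
Lemma jumpE (s : J) (x : T) : sigma s x = x + sigma s 0.
Proof. by case: b s => -[l n] /=; [case: n|]; rewrite add0r. Qed.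

Lemma jumpC (s s' : J) (x : T) : sigma s (sigma s' x) = sigma s' (sigma s x).
Proof. by rewrite !(jumpE _ (sigma _ _)) !(jumpE _ x) addrAC. Qed.

Lemma mulrn_torus (v : T) : v *+ m = 0.
Proof. by rewrite -scaler_nat pchar_Zp// scale0r. Qed.

Lemma jump_inv (s : J) : exists s' : J, forall x : T, sigma s' (sigma s x) = x.
Proof.
suff [s' E] : exists s' : J, sigma s 0 + sigma s' 0 = 0.
  by exists s' => x; rewrite (jumpE s') jumpE -addrA E addr0.
case: b s => -[l n] /=.
  by exists (l, ~~ n); case: n => /=; rewrite !add0r ?addrN ?addNr.
(* The index [n] stands for the displacement [n.+1], so [rev_ord n] stands for [m - n.+1]. *)
exists (l, rev_ord n); rewrite /= !add0r -mulrnDr.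
have -> : (n.+1 + (m.-1 - n.+1).+1 = m)%N.
  by rewrite addnS subnKC ?ltn_ord// prednK// ltnW.
exact: mulrn_torus.
Qed.

Lemma jump_unit (l : 'I_d) : exists2 s : J, axis s = l & sigma s 0 = delta_mx 0 l.
Proof.
case: b; first by exists (l, true); rewrite //= add0r.
have m0 : (0 < m.-1)%N by rewrite -ltnS prednK// ltnW.
by exists (l, Ordinal m0); rewrite //= add0r mulr1n.
Qed.

Lemma jump_axis (s : J) (i : 'I_d) : i != axis s -> (sigma s 0) 0 i = 0.
Proof.
case: b s => -[l n] /= /negbTE il; last by rewrite add0r mulmxnE !mxE il andbF mul0rn.
by case: n; rewrite !mxE il andbF ?addr0 ?subr0// ?sub0r ?oppr0.
Qed.

Lemma torus_axisE (x y : T) (l : 'I_d) : (forall i, i != l -> x 0 i = y 0 i) ->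
  y = x + delta_mx 0 l *+ (y 0 l - x 0 l)%R.
Proof.
move=> xy; apply/rowP => i; rewrite !mxE mulmxnE !mxE.
case: (eqVneq i l) => [->|il]; last by rewrite mul0rn addr0 xy.
by rewrite !eqxx /= (natr_Zp (y 0 l - x 0 l)) addrC subrK.
Qed.

(** Rates of the walk that moves along the axis [l] only; the base walk is the commuting sum of
    these. *)
Definition axis_rate (l : 'I_d) (s : J) : R := lam * (axis s == l)%:R.

Local Notation axis_kernel l := (jump_kernel sigma (axis_rate l)).

Lemma jump_rate_gt0 : 0 < lam.
Proof. by rewrite /jump_rate; case: b; rewrite invr_gt0 ltr0n// ltnW. Qed.

Lemma axis_rate_ge0 l s : 0 <= axis_rate l s.
Proof. by rewrite mulr_ge0// ltW// jump_rate_gt0. Qed.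

Lemma axis_kernel_off l n (x y : T) :
  ~ (forall i, i != l -> x 0 i = y 0 i) -> gen_pow (axis_kernel l) n x y = 0.
Proof.
elim: n x => [|n IH] x xy.
  rewrite gen_pow0 /kid; case: eqVneq => // E; case: xy => i _; by rewrite E.
rewrite gen_powS kmul_jump big1// => s _.
rewrite /axis_rate; case: (eqVneq (axis s) l) => [sl|_]; last by rewrite mulr0 mul0r.
rewrite IH ?mulr0// => H; apply: xy => i il; rewrite -H// jumpE mxE jump_axis ?addr0//.
by rewrite sl.
Qed.

Lemma axis_kernel_sum l (x : T) : \sum_y axis_kernel l x y <= 1.
Proof.
have -> : \sum_y axis_kernel l x y = \sum_s axis_rate l s.
  transitivity (kapp (axis_kernel l) (fun=> 1) x).
    by apply: eq_bigr => y _; rewrite mulr1.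
  rewrite /kapp /jump_kernel; under eq_bigr do rewrite mulr1.
  rewrite exchange_big/=; apply: eq_bigr => s _; rewrite -mulr_sumr.
  rewrite (bigD1 (sigma s x))//= eqxx big1 ?addr0 ?mulr1// => y.
  by rewrite eq_sym => /negbTE ->.
rewrite -mulr_sumr -natr_sum.
(* The total rate along one axis is 1 for NNRW and [(m - 1) / m] for URW. *)
have -> : (\sum_(s : J) (axis s == l) = match b with NNRW => 2 | URW => m.-1 end)%N.
  case: b => /=.
    rewrite -(pair_bigA _ (fun (i : 'I_d) (n : bool) => (i == l : nat)))/=.
    rewrite (bigD1 l)//= [X in (_ + X)%N]big1 => [|i /negbTE ->]; last by rewrite big1.
    by rewrite eqxx sum1_card card_bool.
  rewrite -(pair_bigA _ (fun (i : 'I_d) (n : 'I_m.-1) => (i == l : nat)))/=.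
  rewrite (bigD1 l)//= [X in (_ + X)%N]big1 => [|i /negbTE ->]; last by rewrite big1.
  by rewrite eqxx sum1_card card_ord addn0.
have m0 : 0 < m%:R :> R by rewrite ltr0n ltnW.
rewrite /jump_rate; case: b; first by rewrite mulVf.
by rewrite mulrC ler_pdivrMr// mul1r ler_nat leq_pred.
Qed.

(** For URW, distinct operators along one axis lead to distinct states, so at most one term is
    nonzero. For NNRW the row sum is used; the bound is attained for [m = 2], where both operators
    agree. *)
Lemma axis_kernel_le l (x y : T) :
  axis_kernel l x y <= match b with NNRW => 1 | URW => m%:R^-1 end.
Proof.
have : axis_kernel l x y <= 1.
  apply: le_trans (axis_kernel_sum l x); rewrite (bigD1 y)//= lerDl.
  by apply: sumr_ge0 => z _; apply: jump_kernel_ge0 => s; exact: axis_rate_ge0.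
rewrite /jump_kernel /axis_rate; case: b => //= _.
under eq_bigr do rewrite -mulrA -natrM mulnb.
rewrite -mulr_sumr -natr_sum ler_piMr ?invr_ge0//.
rewrite [X in X%:R](_ : _ = #|[pred s : 'I_d * 'I_m.-1 |
    (s.1 == l) && (x + delta_mx 0 s.1 *+ s.2.+1 == y)]|); last first.
  rewrite -sum1_card [RHS]big_mkcond/=; apply: eq_bigr => s _.
  by rewrite inE/=; case: (_ && _).
rewrite lern1; apply/card_le1_eqP => -[l1 n1] [l2 n2]; rewrite !inE/=.
move=> /andP[/eqP -> /eqP xn1] /andP[/eqP -> /eqP xn2]; congr pair.
have := etrans xn1 (esym xn2) => /addrI /rowP/(_ l).
rewrite !mulmxnE !mxE !eqxx /= => /(congr1 (@nat_of_ord _)).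
have nm (n : 'I_m.-1) : (n.+1 < m)%N by have := ltn_ord n; lia.
rewrite -![1 *+ _]/(_%:R) !val_Zp_nat// !modn_small// => -[] /val_inj.
by [].
Qed.

Lemma axis_kernel_pow_ge l k (x : T) :
  lam ^+ k <= gen_pow (axis_kernel l) k x (x + delta_mx 0 l *+ k).
Proof.
elim: k x => [|k IH] x; first by rewrite mulr0n addr0 gen_pow0 /kid eqxx.
have [s sl se] := jump_unit l.
rewrite gen_powS kmul_jump (bigD1 s)//= exprS; apply: ler_wpDr.
  apply: sumr_ge0 => i _; rewrite mulr_ge0 ?axis_rate_ge0 ?gen_pow_ge0// => ? ?.
  by apply: jump_kernel_ge0 => ?; exact: axis_rate_ge0.
rewrite /axis_rate sl eqxx mulr1 ler_wpM2l ?(ltW jump_rate_gt0)//.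
by rewrite jumpE se mulrS addrA IH.
Qed.

(** The constant is [3 * m] for NNRW and 6 for URW. It must dominate [2 * j + 3], where [j] is the
    number of jumps used to reach [y] along the axis: [j <= m - 1] for NNRW, [j <= 1] for URW. *)
Lemma axis_kernel_harnack l t (x y : T) : 0 < t <= 1 ->
  t * kmul (axis_kernel l) (semigroup (axis_kernel l) t) x y <=
  6 * lam * m%:R * semigroup (axis_kernel l) t x y.
Proof.
move=> tI.
have K0 (x' y' : T) : 0 <= axis_kernel l x' y'.
  by apply: jump_kernel_ge0 => s; exact: axis_rate_ge0.
have m0 : 0 < m%:R :> R by rewrite ltr0n ltnW.
pose beta : R := match b with NNRW => 1 | URW => m%:R^-1 end.
have Kbeta (x' y' : T) : axis_kernel l x' y' <= beta by exact: axis_kernel_le.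
apply: (@semigroup_harnack _ _ _ beta) => //; first by exact: axis_kernel_sum.
case: (pselect (forall i, i != l -> x 0 i = y 0 i)) => [xy|xy]; last first.
  by left => n; exact: axis_kernel_off.
right; rewrite {1}(torus_axisE xy); set k := nat_of_ord _.
have km : (k < m)%N.
  have := ltn_ord (y 0 l - x 0 l); by rewrite [X in (_ < X)%N]Zp_cast.
have Kk := @axis_kernel_pow_ge l k x; move: Kk; rewrite /beta /axis_rate.
(* NNRW takes [k] unit steps of rate 1/2, hence the mass [2 ^- k]. URW stays put when [k = 0] and
   otherwise jumps once. *)
case: b => /= Kk; last case: k km {Kk} => [|k] km.
- exists k; first by rewrite mul1r -exprVn.
  rewrite [6 * _](_ : _ = 3); last by field.
  have : (2 * k + 3 <= 3 * m)%N by lia.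
  by rewrite -(ler_nat R) natrD !natrM.
- exists 0%N.
    rewrite mulr0n addr0 gen_pow0 /kid eqxx divr1 invf_le1//.
    by rewrite ler1n ltnW.
  by rewrite mulr0 add0r -mulrA mulVf ?gt_eqF// mulr1 ler_nat.
- exists 1%N; last by rewrite -mulrA mulVf ?gt_eqF// !mulr1 -natrD ler_nat.
  have k1 : (k < m.-1)%N by rewrite -ltnS prednK// ltnW.
  rewrite gen_powS gen_pow0 kmul1 /jump_kernel expr1.
  rewrite (bigD1 (l, Ordinal k1))//= !eqxx !mulr1; apply: ler_wpDr.
    by apply: sumr_ge0 => s _; rewrite !mulr_ge0// invr_ge0.
  by rewrite ler_piMr ?invr_ge0// invf_le1// ler1n.
Qed.

Let P t := base_trans sigma lam t.

Lemma base_trans_ge0 t (x y : T) : 0 <= t -> 0 <= P t x y.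
Proof. by move=> t0; apply: semigroup_generator_ge0 => // s; exact: ltW jump_rate_gt0. Qed.

(** The moves along [l] commute with the others, so the heat kernel factorizes; the axis inequality
    is applied to the first factor and integrated against the second. *)
Lemma base_trans_axis_rate l t (x y : T) : 0 < t <= 1 ->
  t * \sum_(s : J) axis_rate l s * P t (sigma s x) y <= 6 * lam * m%:R * P t x y.
Proof.
move=> tI; have t0 : 0 <= t by case/andP: tI => /ltW.
pose rest (s : J) := lam * (axis s != l)%:R.
have rest0 s : 0 <= rest s by rewrite mulr_ge0// ltW// jump_rate_gt0.
have -> : \sum_(s : J) axis_rate l s * P t (sigma s x) y = kmul (axis_kernel l) (P t) x y.
  by rewrite kmul_jump.
have E : jump_kernel sigma (fun=> lam) =
    fun x y => axis_kernel l x y + jump_kernel sigma rest x y.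
  apply/funext => u; apply/funext => v.
  rewrite /jump_kernel -big_split/=; apply: eq_bigr => s _.
  rewrite -mulrDl /axis_rate /rest -mulrDr; case: (axis s == l) => /=.
    by rewrite addr0 mulr1.
  by rewrite add0r mulr1.
have -> : P t = fun x y => expR (- (t * \sum_(s : J) lam)) *
   kmul (semigroup (axis_kernel l) t) (semigroup (jump_kernel sigma rest) t) x y.
  apply/funext => x'; apply/funext => y'.
  rewrite -[LHS]/(semigroup (generator sigma (fun=> lam)) t x' y') semigroup_generator E.
  by rewrite semigroupD//; exact: (jump_kernelC jumpC).
rewrite kmulZr mulrCA [leRHS]mulrCA ler_wpM2l ?expR_ge0//.
rewrite kmulA /kmul !mulr_sumr; apply: ler_sum => z _; rewrite !mulrA.
rewrite ler_wpM2r//; last by exact: axis_kernel_harnack.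
by apply: semigroup_ge0 => // ? ?; exact: jump_kernel_ge0.
Qed.

Lemma base_trans_rate t (x y : T) : 0 < t <= 1 ->
  \sum_(s : J) lam * P t (sigma s x) y <= 6 * lam * d%:R * m%:R / t * P t x y.
Proof.
move=> tI; have t0 : 0 < t by case/andP: tI.
rewrite mulrAC ler_pdivlMr// mulrC.
have -> : \sum_(s : J) lam * P t (sigma s x) y =
    \sum_(l < d) \sum_(s : J) axis_rate l s * P t (sigma s x) y.
  rewrite exchange_big/=; apply: eq_bigr => s _; rewrite -mulr_suml; congr (_ * _).
  rewrite /axis_rate -mulr_sumr (bigD1 (axis s))//= eqxx big1 ?addr0 ?mulr1// => l.
  by rewrite eq_sym => /negbTE ->.
rewrite mulr_sumr; apply: le_trans (_ : \sum_(l < d) 6 * lam * m%:R * P t x y <= _).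
  by apply: ler_sum => l _; exact: base_trans_axis_rate.
by rewrite sumr_const card_ord -mulr_natl le_eqVlt; apply/orP; left; apply/eqP; ring.
Qed.

(** One operator is a single term of the sum along its own axis; its rate [lam] cancels and no
    factor [d] appears. *)
Lemma base_trans_jump_le t s (x y : T) : 0 < t <= 1 ->
  P t (sigma s x) y <= 6 * m%:R / t * P t x y.
Proof.
move=> tI; have t0 : 0 < t by case/andP: tI.
have := @base_trans_axis_rate (axis s) t x y tI.
move=> H; rewrite mulrAC ler_pdivlMr// [_ * t]mulrC -(ler_pM2l jump_rate_gt0).
have -> : lam * (6 * m%:R * P t x y) = 6 * lam * m%:R * P t x y by ring.
apply: le_trans H; rewrite mulrCA ler_wpM2l ?(ltW t0)// (bigD1 s)//=.
rewrite /axis_rate eqxx mulr1 lerDl; apply: sumr_ge0 => i _.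
by rewrite mulr_ge0 ?base_trans_ge0 ?(ltW t0)// (axis_rate_ge0 (axis s)).
Qed.

Lemma base_trans_jump_ge t s (x y : T) : 0 < t <= 1 ->
  P t x y <= 6 * m%:R / t * P t (sigma s x) y.
Proof.
move=> tI; have [s' s'K] := jump_inv s.
by rewrite -{1}(s'K x); exact: base_trans_jump_le.
Qed.

(** The diagonal entry is positive by the term without jumps, and the Harnack bound carries
    positivity from [y] back to [x] along unit jumps, axis by axis. *)
Lemma base_trans_gt0 t (x y : T) : 0 < t <= 1 -> 0 < P t x y.
Proof.
move=> tI; have t0 : 0 < t by case/andP: tI.
have c0 : 0 < 6 * m%:R / t.
  by rewrite divr_gt0// mulr_gt0// ltr0n ltnW.
have step s x' : 0 < P t (sigma s x') y -> 0 < P t x' y.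
  move=> H; rewrite -(pmulr_rgt0 _ c0).
  by apply: lt_le_trans H _; exact: base_trans_jump_le.
have stepe l k x' : 0 < P t (x' + delta_mx 0 l *+ k) y -> 0 < P t x' y.
  elim: k x' => [|k IH] x'; first by rewrite mulr0n addr0.
  have [s _ se] := jump_unit l.
  rewrite mulrS addrA => /IH H; apply: (step s).
  by rewrite jumpE se.
suff H (r : seq 'I_d) x' : 0 < P t (x' + \sum_(l <- r) delta_mx 0 l *+ ((y - x) 0 l)%R) y -> 0 < P t x' y.
  apply: (H (index_enum _)).
  have -> : x + \sum_l delta_mx 0 l *+ ((y - x) 0 l)%R = y.
    rewrite -[RHS](subrK x) addrC; congr (_ + _).
    rewrite [RHS]row_sum_delta; apply: eq_bigr => l _.
    by rewrite -scaler_nat natr_Zp.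
  rewrite /P /base_trans semigroup_generator mulr_gt0 ?expR_gt0//.
  apply: lt_le_trans (@semigroup_term_le _ _ _ t 0 y y (ltW t0) _).
    by rewrite gen_pow0 /kid eqxx expr0 fact0 divr1 !mulr1.
  by move=> ? ?; apply: jump_kernel_ge0 => ?; exact: ltW jump_rate_gt0.
elim: r x' => [|l r IH] x'; first by rewrite big_nil addr0.
by rewrite big_cons addrA => /IH; exact: stepe.
Qed.

End Torus.

(** * Chain rule and finite-dimensional laws *)

Section LogSum.
Context {R : realType} {T : finType}.
Implicit Types (mu nu : T -> R) (p S : T -> T -> R).

Lemma ln_le_sub1 (x : R) : 0 < x -> ln x <= x - 1.
Proof.
move=> x0; have := @le_ln1Dx R (x - 1); rewrite (addrC 1) subrK; apply.
by rewrite ltrBrDr addNr.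
Qed.

Lemma log_sum (a b : T -> R) : (forall i, 0 <= a i) -> (forall i, 0 <= b i) ->
  (forall i, b i = 0 -> a i = 0) ->
  (\sum_i a i) * ln ((\sum_i a i) / \sum_i b i) <= \sum_i a i * ln (a i / b i).
Proof.
move=> a0 b0 ab; set A := \sum_i a i; set B := \sum_i b i.
have A0 : 0 <= A by exact: sumr_ge0.
have B0 : 0 <= B by exact: sumr_ge0.
have [AE|AN0] := eqVneq A 0.
  rewrite AE mul0r big1// => i _.
  by rewrite ((psumr_eq0P (fun i _ => a0 i) AE) i)// mul0r.
have Ap : 0 < A by rewrite lt_neqAle eq_sym AN0.
have Bp : 0 < B.
  rewrite lt_neqAle B0 andbT; apply: contra_neq AN0 => /esym BE.
  by apply: big1 => i _; apply: ab; apply: (psumr_eq0P (fun i _ => b0 i) BE).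
(* Tangent bound for [ln] at the quotient of [A / B] by [a i / b i]; the right sides add up to
   zero. *)
have step i : a i * ln (A / B) - a i * ln (a i / b i) <= A / B * b i - a i.
  have := a0 i; rewrite le_eqVlt => /orP[/eqP <-|ai].
    by rewrite !mul0r !subr0 mulr_ge0// divr_ge0.
  have bi : 0 < b i.
    by rewrite lt_neqAle b0 andbT; apply: contraTneq ai => /esym /ab ->; rewrite ltxx.
  rewrite -mulrBr -ln_div ?posrE ?divr_gt0//.
  apply: le_trans (_ : a i * (A / B / (a i / b i) - 1) <= _).
    by rewrite ler_wpM2l ?(ltW ai)// ln_le_sub1// !divr_gt0.
  by rewrite le_eqVlt; apply/orP; left; apply/eqP; field; rewrite !gt_eqF.
rewrite -subr_le0 {1}/A mulr_suml -sumrB.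
apply: le_trans (ler_sum _ (fun i _ => step i)) _.
by rewrite sumrB -mulr_sumr -/A -/B divfK ?gt_eqF// subrr.
Qed.

(** The log-sum inequality over the earlier state bounds the divergence of the later marginals by
    that of the joint laws, which splits by the chain rule. *)
Lemma relent_chain mu nu p S :
  (forall z, 0 <= mu z) -> (forall z, 0 <= nu z) ->
  (forall z, nu z = 0 -> mu z = 0) ->
  (forall z y, 0 < mu z -> 0 < p z y) -> (forall z y, 0 < mu z -> 0 < S z y) ->
  (forall z y, 0 <= S z y) ->
  (forall z, 0 < mu z -> \sum_y p z y = 1) ->
  let mu' := fun y => \sum_z mu z * p z y in
  let nu' := fun y => \sum_z nu z * S z y in
  (forall y, nu' y = 0 -> mu' y = 0) /\
  \sum_y mu' y * ln (mu' y / nu' y) <= \sum_z mu z * ln (mu z / nu z) +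
    \sum_z mu z * \sum_y p z y * ln (p z y / S z y).
Proof.
move=> mu0 nu0 munu p0 Sp S0 p1 mu' nu'.
have mu0V z : mu z = 0 \/ 0 < mu z.
  by have := mu0 z; rewrite le_eqVlt => /orP[/eqP <-|]; [left|right].
have nup z : 0 < mu z -> 0 < nu z.
  move=> muz; rewrite lt_neqAle nu0 andbT.
  by apply: contraTneq muz => /esym /munu ->; rewrite ltxx.
have ac z y : nu z * S z y = 0 -> mu z * p z y = 0.
  have [->|muz] := mu0V z; first by rewrite mul0r.
  by move=> /eqP; rewrite gt_eqF// mulr_gt0 ?nup ?Sp.
split.
  move=> y /psumr_eq0P H; apply: big1 => z _; apply: ac; apply: H => // i _.
  by rewrite mulr_ge0.
apply: le_trans (_ : \sum_y \sum_z (mu z * p z y) * ln (mu z * p z y / (nu z * S z y)) <= _).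
  apply: ler_sum => y _; apply: log_sum => [z|z|z]; last exact: ac.
    by have [->|muz] := mu0V z; [rewrite mul0r | rewrite mulr_ge0// ltW// p0].
  by rewrite mulr_ge0.
rewrite exchange_big/= -big_split/=; apply: ler_sum => z _.
have [->|muz] := mu0V z; first by rewrite !mul0r addr0 big1// => y _; rewrite !mul0r.
rewrite le_eqVlt; apply/orP; left; apply/eqP.
rewrite -[mu z * ln _ in RHS]mulr1 -(p1 z muz) mulr_sumr mulr_sumr -big_split/=.
apply: eq_bigr => y _.
have E : mu z * p z y / (nu z * S z y) = (mu z / nu z) * (p z y / S z y).
  by rewrite invfM !mulrA; congr (_ * _); rewrite mulrAC.
rewrite E lnM ?posrE ?divr_gt0 ?nup ?p0 ?Sp//; ring.
Qed.

End LogSum.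

(** * One-time marginals of the two processes *)

Section ProcessFacts.
Context {R : realType} {T : finType} {dsp : measure_display}.
Context {Omega : measurableType dsp}.
Variable P : probability Omega R.
Implicit Types X : R -> Omega -> T.

Lemma cylinder_cons X t x l :
  cylinder X ((t, x) :: l) = X t @^-1` [set x] `&` cylinder X l.
Proof.
apply/seteqP; split=> w /=.
  move=> H; split; first by apply: (H (t, x)); rewrite inE eqxx.
  by move=> tx txl; apply: H; rewrite inE txl orbT.
by move=> [Xw H] tx; rewrite inE => /orP[/eqP ->|/H].
Qed.

Lemma cylinder_nil X : cylinder X [::] = setT.
Proof. by apply/seteqP; split=> w. Qed.

Lemma prob_partition (Y : Omega -> T) A : measurable A ->
  (forall x, measurable (Y @^-1` [set x])) ->
  P A = (\sum_x P (A `&` Y @^-1` [set x]))%E.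
Proof.
move=> mA mY.
have mF x : measurable (A `&` Y @^-1` [set x]) by exact: measurableI.
have -> : P A = P (\bigcup_(x in [set: T]) (A `&` Y @^-1` [set x])).
  congr (P _); apply/seteqP; split=> w /=; last by move=> [x _ []].
  by move=> Aw; exists (Y w).
have TE : [set: T] = [set` index_enum T].
  by apply/seteqP; split=> x //= _; rewrite mem_index_enum.
rewrite measure_fin_bigcup//.
- by rewrite TE -fsbig_seq// index_enum_uniq.
- exact: finite_finset.
- by move=> x y _ _ [w [[_ <-] [_ <-]]].
Qed.

Lemma prob_law X b t x : rv_on b X -> 0 <= t <= b ->
  P (X t @^-1` [set x]) = (law P X t x)%:E.
Proof. by move=> mX tb; rewrite /law fineK// fin_num_measure//; exact: mX. Qed.

Lemma law_ge0 X t x : 0 <= law P X t x.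
Proof. exact: fine_ge0. Qed.

Lemma interpolant_law p pi X t x : interpolant P p pi X -> 0 <= t <= 1 ->
  law P X t x = \sum_x0 \sum_x1 pi x0 x1 * (p t x0 x * p (1 - t) x x1 / p 1 x0 x1).
Proof.
move=> [mX cyl] /andP[t0 t1].
have mXt s y : 0 <= s <= 1 -> measurable (X s @^-1` [set y]) by exact: mX.
have m0 y : measurable (X 0 @^-1` [set y]) by apply: mXt; rewrite lexx ler01.
have m1 y : measurable (X 1 @^-1` [set y]) by apply: mXt; rewrite lexx ler01.
have mt : measurable (X t @^-1` [set x]) by apply: mXt; rewrite t0.
apply: EFin_inj; rewrite -(@prob_law X 1)//; last by rewrite t0.
rewrite (@prob_partition (X 0))// -sumEFin; apply: eq_bigr => x0 _.
rewrite (@prob_partition (X 1))//; last exact: measurableI.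
rewrite -sumEFin; apply: eq_bigr => x1 _.
rewrite -(setIC (X 0 @^-1` [set x0])) -setIA.
have := cyl x0 x1 [:: (t, x)]; rewrite /= !cylinder_cons cylinder_nil setIT.
rewrite t0 t1 => -> //; congr EFin; rewrite subr0 mulr1; congr (_ * _).
Qed.

Lemma frozen_process_law mu0 tg K (Q : nat -> T -> T -> T -> R) X k y :
  frozen_process P mu0 tg K Q X -> (k < K)%N ->
  (forall k, 0 <= tg k) -> (forall k, tg k <= tg k.+1) -> tg k.+1 <= tg K ->
  law P X (tg k.+1) y =
  \sum_z law P X (tg k) z * semigroup (Q k z) (tg k.+1 - tg k) z y.
Proof.
move=> [mX _ frz] kK tg0 tgS tgK.
have kb : 0 <= tg k <= tg K by rewrite tg0 (le_trans (tgS k)).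
have kb' : 0 <= tg k.+1 <= tg K by rewrite tg0.
apply: EFin_inj; rewrite -(prob_law _ mX)//.
rewrite (@prob_partition (X (tg k)))//; [|exact: mX|by move=> z; exact: mX].
rewrite -sumEFin; apply: eq_bigr => z _.
(* No past, and the right end point of the interval as the only future time. *)
have := frz k z [::] [:: (tg k.+1, y)] kK.
rewrite /= !cylinder_cons cylinder_nil !setIT setIC tgS lexx => ->//.
by rewrite mulr1 (prob_law _ mX).
Qed.

Lemma integral_law X b t (f : T -> \bar R) : rv_on b X -> 0 <= t <= b ->
  (forall x, (0 <= f x)%E) ->
  (\int[P]_w f (X t w) = \sum_x (law P X t x)%:E * f x)%E.
Proof.
move=> mX tb f0.
have mXt x : measurable (X t @^-1` [set x]) by exact: mX.
have cover : [set: Omega] = \big[setU/set0]_(x <- index_enum T) (X t @^-1` [set x]).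
  rewrite -bigcup_seq; apply/seteqP; split=> w // _.
  by exists (X t w) => //=; rewrite mem_index_enum.
rewrite cover ge0_integral_bigsetU//.
- apply: eq_bigr => x _.
  rewrite (eq_integral (fun=> f x)); last by move=> w; rewrite inE/= => ->.
  rewrite integral_cst// muleC; congr (_ * _)%E.
  exact: (prob_law _ mX tb).
- exact: index_enum_uniq.
- by move=> x y _ _ [w [<- <-]].
- move=> _ B mB; rewrite -cover setTI.
  have -> : (fun w => f (X t w)) @^-1` B = \bigcup_(x in f @^-1` B) (X t @^-1` [set x]).
    apply/seteqP; split=> w /=; first by move=> Bw; exists (X t w).
    by move=> [x Bx Xw]; rewrite Xw.
  by apply: fin_bigcup_measurable => //; exact: finite_finset.
Qed.

End ProcessFacts.

(** * One step of the interpolant as a Doob transform *)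

Section Bridge.
Context {R : realType}.
Variables (b : walk) (d m : nat).
Hypothesis m1 : (1 < m)%N.
Local Notation T := (torus d m).
Local Notation J := (jumps b d m).
Local Notation sigma := (@jump b d m).
Local Notation lam := (jump_rate R b m).
Variable pi : T -> T -> R.
Hypothesis pi0 : forall x y, 0 <= pi x y.
Let P := base_trans sigma lam.
Let mu := interp_marginal sigma lam pi.
Let pit := pi_tilde sigma lam pi.

Lemma pi_tilde_ge0 x y : 0 <= pit x y.
Proof. by rewrite divr_ge0// base_trans_ge0. Qed.

Lemma base_trans_add s t : P (s + t) = kmul (P s) (P t).
Proof. exact: semigroup_add. Qed.

Lemma interp_marginal_ge0 t z : 0 <= t <= 1 -> 0 <= mu t z.
Proof.
move=> /andP[t0 t1]; apply: sumr_ge0 => x0 _; apply: sumr_ge0 => x1 _.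
by rewrite mulr_ge0 ?pi_tilde_ge0// mulr_ge0// base_trans_ge0// subr_ge0.
Qed.

(* The conditional law of X^I_{t'} given X^I_t = z; since X^I need not be a Markov
   chain, these kernels do not compose. *)
Definition bridge_kernel t t' z y : R :=
  (\sum_x0 \sum_x1 P t x0 z * P (t' - t) z y * P (1 - t') y x1 * pit x0 x1) / mu t z.

Lemma interp_marginal_step t t' y : 0 <= t < 1 ->
  mu t' y = \sum_z mu t z * bridge_kernel t t' z y.
Proof.
move=> /andP[t0 t1].
transitivity (\sum_z \sum_x0 \sum_x1 P t x0 z * P (t' - t) z y * P (1 - t') y x1 * pit x0 x1).
  rewrite exchange_big/=; apply: eq_bigr => x0 _; rewrite exchange_big/=.
  apply: eq_bigr => x1 _; rewrite -!mulr_suml; congr (_ * _ * _).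
  by rewrite -[RHS]/(kmul (P t) (P (t' - t)) x0 y) -base_trans_add (addrC t) subrK.
apply: eq_bigr => z _; rewrite /bridge_kernel.
have [muz|muz] := eqVneq (mu t z) 0; last by rewrite mulrCA divff// mulr1.
(* Where [mu t z] vanishes so does each summand: [P (1 - t) z x1] is positive, so [P t x0 z] or
   [pit x0 x1] is zero. *)
rewrite muz mul0r big1// => x0 _; rewrite big1// => x1 _.
have t1' : 0 <= 1 - t by rewrite subr_ge0 ltW.
have g0 (v w : T) : 0 <= P t v z * P (1 - t) z w * pit v w.
  by rewrite mulr_ge0 ?pi_tilde_ge0// mulr_ge0// base_trans_ge0.
have /psumr_eq0P H1 := muz.
have /psumr_eq0P H2 := H1 (fun x0 _ => sumr_ge0 _ (fun x1 _ => g0 x0 x1)) x0 isT.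
have /eqP := H2 (fun x1 _ => g0 x0 x1) x1 isT.
rewrite mulrAC mulf_eq0 (gt_eqF (@base_trans_gt0 _ b d m m1 (1 - t) z x1 _)).
  rewrite orbF => /eqP E.
  rewrite [LHS](_ : _ = P t x0 z * pit x0 x1 * (P (t' - t) z y * P (1 - t') y x1)); last by ring.
  by rewrite E mul0r.
by rewrite subr_gt0 t1 gerBl.
Qed.

(** Density of the conditional law of the end point, given the state [z] at time [t], with respect
    to [P (1 - t) z]. *)
Let kap t z x1 : R := (\sum_x0 P t x0 z * pit x0 x1) / mu t z.

Lemma bridge_kapE t z r y :
  (\sum_x0 \sum_x1 P r y x1 * P t x0 z * pit x0 x1) / mu t z = kapp (P r) (kap t z) y.
Proof.
rewrite /kapp /kap exchange_big/= mulr_suml; apply: eq_bigr => x1 _.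
by rewrite mulrA; congr (_ / _); rewrite mulr_sumr; apply: eq_bigr => x0 _; rewrite mulrA.
Qed.

(** Given [z], the next state has law [P tau z y * F y], and [kapp (P tau) F] is the score seen from
    [z]. [one_step_relent] applies, with [L] and [rho] from the Harnack inequality at the remaining
    time [1 - t']. *)
Lemma bridge_step t t' z (r : J -> R) : 0 <= t -> t < t' -> t' < 1 -> 0 < mu t z ->
  (forall s, 0 < r s) ->
  let p := bridge_kernel t t' z in
  let S := semigroup (generator sigma r) (t' - t) z in
  let a := op_rate sigma lam (score sigma lam pi) t z in
  let L := 6 * lam * d%:R * m%:R / (1 - t') in
  let rho := 6 * m%:R / (1 - t') in
  [/\ forall y, 0 < p y, \sum_y p y = 1, forall y, 0 < S y, forall s, 0 < a s &
    \sum_y p y * ln (p y / S y) <=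
      (t' - t) * (\sum_s (a s * ln (a s / r s) - a s + r s)) +
      (t' - t) ^+ 2 * (L ^+ 2 * (2 * ln rho + 1))].
Proof.
move=> t0 tt' t'1 muz r0 p S a L rho.
set tau := t' - t; set s1 := 1 - t'.
have lam0 : 0 < lam by exact: jump_rate_gt0.
have m0 : 0 < m%:R :> R by rewrite ltr0n ltnW.
have tau0 : 0 < tau by rewrite subr_gt0.
have s10 : 0 < s1 by rewrite subr_gt0.
have s11 : s1 <= 1 by rewrite gerBl (le_trans t0)// ltW.
have s1I : 0 < s1 <= 1 by rewrite s10.
have taus : tau + s1 = 1 - t by rewrite /tau /s1; ring.
pose F := kapp (P s1) (kap t z).
have kap0 x1 : 0 <= kap t z x1.
  rewrite divr_ge0 ?(ltW muz)//; apply: sumr_ge0 => x0 _.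
  by rewrite mulr_ge0 ?pi_tilde_ge0// base_trans_ge0.
have PF : kapp (P tau) F = kapp (P (1 - t)) (kap t z).
  by rewrite /F -taus (base_trans_add tau) kapp_kmul.
have scE y : score sigma lam pi t z y = kapp (P tau) F y by rewrite PF -bridge_kapE.
have Fz : kapp (P tau) F z = 1.
  rewrite -scE /score [X in X / _](_ : _ = mu t z) ?divff ?gt_eqF//.
  by apply: eq_bigr => x0 _; apply: eq_bigr => x1 _; rewrite [P _ _ _ * _]mulrC.
(* Some end point is charged, for otherwise the mean of [F] would be 0 and not 1; this makes [F]
   positive everywhere. *)
have [x1 kx1] : exists x1, 0 < kap t z x1.
  apply: contrapT => H; have k0 x1 : kap t z x1 = 0.
    by apply/eqP; rewrite eq_le kap0 andbT leNgt; apply/negP => k; apply: H; exists x1.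
  move: Fz; rewrite PF /kapp big1 => [/eqP|y _]; last by rewrite k0 mulr0.
  by rewrite eq_sym oner_eq0.
have F0 y : 0 < F y.
  rewrite /F /kapp (bigD1 x1)//=; apply: ltr_wpDr; last first.
    by rewrite mulr_gt0 ?base_trans_gt0.
  by apply: sumr_ge0 => x _; rewrite mulr_ge0// base_trans_ge0// ltW.
have pE y : p y = P tau z y * F y.
  rewrite /p /bridge_kernel /F -bridge_kapE mulrA; congr (_ / _).
  rewrite mulr_sumr; apply: eq_bigr => x0 _; rewrite mulr_sumr; apply: eq_bigr => x2 _.
  by rewrite -/tau -/s1; ring.
have PF0 y : 0 < kapp (P tau) F y.
  by apply: kapp_gt0 => //; rewrite ?(ltW tau0)// => _; exact: ltW.
have tauI : 0 < tau <= 1 by rewrite tau0 /tau; lra.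
have P0 y : 0 < P tau z y by exact: base_trans_gt0.
have FL x : \sum_s lam * F (sigma s x) <= L * F x.
  rewrite /F /kapp mulr_sumr; under eq_bigr do rewrite mulr_sumr.
  rewrite exchange_big/=; apply: ler_sum => y _.
  under eq_bigr do rewrite mulrA; rewrite -mulr_suml mulrA ler_wpM2r//.
  exact: base_trans_rate.
have Frho s x : F (sigma s x) <= rho * F x.
  rewrite /F /kapp mulr_sumr; apply: ler_sum => y _.
  by rewrite [leRHS]mulrA ler_wpM2r// base_trans_jump_le.
have Frho' s x : F x <= rho * F (sigma s x).
  rewrite /F /kapp mulr_sumr; apply: ler_sum => y _.
  by rewrite [leRHS]mulrA ler_wpM2r// base_trans_jump_ge.
have L0 : 0 <= L by rewrite divr_ge0 ?(ltW s10)// !mulr_ge0// ltW.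
have rho1 : 1 <= rho.
  rewrite ler_pdivlMr// mul1r (le_trans s11)//.
  have : (1 : R) <= m%:R by rewrite ler1n ltnW.
  lra.
split.
- by move=> y; rewrite pE mulr_gt0.
- by rewrite -Fz; apply: eq_bigr => y _; rewrite pE.
- move=> y; by have [] := @semigroup_generator_tilt _ _ _ sigma (@jumpC b d m) (fun=> lam)
    r tau z y (fun=> lam0) r0 (ltW tau0) (P0 y).
- by move=> s; rewrite /a /op_rate mulr_gt0// scE.
have := @one_step_relent R _ _ sigma (@jumpC b d m) (fun=> lam) F L rho
  (fun=> ltW lam0) F0 FL Frho Frho' r tau z
   (fun=> lam0) r0 (ltW tau0) L0 rho1 P0 Fz.
under eq_bigr do rewrite -pE.
rewrite -/S; under [X in _ -> _ <= _ * X + _]eq_bigr do rewrite /a /op_rate scE.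
exact.
Qed.

End Bridge.

Section ScoreLoss.
Context {R : realType}.
Implicit Types a b : R.

Lemma phi_ge0 a : 0 <= a -> 0 <= phi a.
Proof.
rewrite /phi le_eqVlt => /orP[/eqP <-|a0]; first by rewrite mul0r; lra.
have := @ln_le_sub1 R a^-1; rewrite invr_gt0 lnV ?posrE// => /(_ a0) H.
have : a * - ln a <= a * (a^-1 - 1) by rewrite ler_wpM2l// ltW.
by rewrite mulrBr divff ?gt_eqF//; lra.
Qed.

Lemma phi_persp_ge0 a b : 0 <= a -> 0 <= b -> (0 <= phi_persp a b)%E.
Proof.
move=> a0 b0; rewrite /phi_persp; case: eqP => _; first by case: eqP.
by rewrite lee_fin mulr_ge0// phi_ge0// divr_ge0.
Qed.

Lemma phi_perspE a b : 0 < b -> phi_persp a b = (a * ln (a / b) - a + b)%:E.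
Proof.
move=> b0; rewrite /phi_persp gt_eqF//; congr EFin; rewrite /phi.
by field; rewrite gt_eqF.
Qed.

Lemma lee_sum_term (I : finType) (f : I -> \bar R) i : (forall j, (0 <= f j)%E) ->
  (f i <= \sum_j f j)%E.
Proof. by move=> f0; rewrite (bigD1 i)//= leeDl// sume_ge0. Qed.

Lemma score_loss_ge0 (T J : finType) (sigma : J -> T -> T) (lam : R)
    (pi : T -> T -> R) (u : R -> T -> T -> R) t x :
  (forall s, 0 <= op_rate sigma lam (score sigma lam pi) t x s) ->
  (forall s, 0 <= op_rate sigma lam u t x s) ->
  (0 <= score_loss sigma lam pi u t x)%E.
Proof.
by move=> a0 b0; apply: sume_ge0 => s _; rewrite adde_ge0 ?phi_persp_ge0// lee_fin sqr_ge0.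
Qed.

End ScoreLoss.

Section Numerics.
Context {R : realType}.

Lemma ln2_ge : (2^-1 : R) <= ln 2.
Proof.
have := @ln_le_sub1 R 2^-1; rewrite invr_gt0 lnV ?posrE//.
move=> /(_ (ltr0Sn _ 1)); lra.
Qed.

(** [ln eta^-1] is [K] times the logarithm of [1 + h], which is at least [h / 2] because [h < 1]. *)
Lemma grid_size_le (h eta : R) K : 0 < h < 1 -> 0 < eta -> (1 + h) ^- K = eta ->
  K%:R * h <= 2 * ln eta^-1.
Proof.
move=> /andP[h0 h1] eta0 E.
have h10 : 0 < 1 + h by lra.
rewrite -E invrK lnXn// -[ln _ *+ _]mulr_natl mulrCA ler_wpM2l//.
have := @ln_le_sub1 R (1 + h)^-1; rewrite invr_gt0 lnV ?posrE// => /(_ h10) H.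
have : (1 + h)^-1 <= 1 - h / 2.
  rewrite -[leLHS]mul1r ler_pdivrMr//; nra.
lra.
Qed.

(** With [X = ln (m / eta)]: as [6 <= 2 ^ 3] and [ln 2 <= X], the logarithm is at most [4 * X], and
    [1 <= 2 * ln 2 <= 2 * X]. *)
Lemma ln_harnack_le (m : nat) (eta s : R) : (1 < m)%N -> 0 < eta < 1 -> eta <= s ->
  2 * ln (6 * m%:R / s) + 1 <= 10 * ln (m%:R * eta^-1).
Proof.
move=> m1 /andP[eta0 eta1] es.
have m2 : 2 <= m%:R :> R by rewrite ler_nat.
have s0 : 0 < s by lra.
have m0 : 0 < m%:R :> R by lra.
have : ln (6 * m%:R / s) <= ln (2 ^+ 3 * (m%:R * eta^-1)).
  rewrite ler_ln ?posrE ?divr_gt0 ?mulr_gt0 ?exprn_gt0 ?invr_gt0//.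
  rewrite -mulrA ler_pM ?mulr_ge0 ?invr_ge0 ?(ltW s0) ?(ltW m0)//; first by lra.
  by rewrite ler_pM2l// lef_pV2 ?posrE.
rewrite [ln (2 ^+ 3 * _)]lnM ?posrE ?exprn_gt0 ?mulr_gt0 ?invr_gt0// lnXn// => H.
have : ln 2 <= ln (m%:R * eta^-1).
  rewrite ler_ln ?posrE ?mulr_gt0 ?invr_gt0//; apply: le_trans m2 _.
  by rewrite ler_peMr ?(ltW m0)// invf_ge1// ltW.
have := ln2_ge; move: H; rewrite -mulr_natl; lra.
Qed.

End Numerics.

(** * Discretization error *)

Lemma law_sum1 (R : realType) (T : finType) (dsp : measure_display)
    (Omega : measurableType dsp) (P : probability Omega R) (X : R -> Omega -> T) b t :
  rv_on b X -> 0 <= t <= b -> \sum_x law P X t x = 1.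
Proof.
move=> mX tb; apply: EFin_inj; rewrite -sumEFin -(@probability_setT _ _ _ P).
rewrite (@prob_partition _ _ _ _ P (X t))//; last by move=> x; exact: mX.
by apply: eq_bigr => x _; rewrite setTI (prob_law _ _ mX).
Qed.

Section Grid.
Context {R : realType}.
Variable h : R.
Hypothesis h0 : 0 < h.
Local Notation tg := (time_grid h).

Lemma onem_time_grid k : 1 - tg k = (1 + h) ^- k.
Proof. by rewrite /time_grid; ring. Qed.

Lemma time_grid_step k : tg k.+1 - tg k = h * (1 - tg k.+1).
Proof.
have E : (1 + h) ^- k = (1 + h) * (1 + h) ^- k.+1.
  by rewrite exprS invfM mulrA divff ?mul1r// gt_eqF// addr_gt0.
rewrite onem_time_grid.
have -> : tg k.+1 - tg k = (1 + h) ^- k - (1 + h) ^- k.+1 by rewrite /time_grid; ring.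
by rewrite E; ring.
Qed.

Lemma time_grid_lt1 k : tg k < 1.
Proof. by rewrite -subr_gt0 onem_time_grid invr_gt0 exprn_gt0// addr_gt0. Qed.

Lemma time_gridS k : tg k < tg k.+1.
Proof. by rewrite -subr_gt0 time_grid_step mulr_gt0// subr_gt0 time_grid_lt1. Qed.

Lemma time_grid_le i j : (i <= j)%N -> tg i <= tg j.
Proof.
move=> /subnK <-; elim: (j - i)%N => // n IH.
by rewrite addSn (le_trans IH)// ltW// time_gridS.
Qed.

Lemma time_grid_ge0 k : 0 <= tg k.
Proof. by apply: le_trans (time_grid_le (leq0n k)); rewrite /time_grid expr0 invr1 subrr. Qed.

End Grid.

Section Discretization.
Context {R : realType}.
Variables (b : walk) (d m : nat) (mu0 mu1 : torus d m -> R)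
  (pi : torus d m -> torus d m -> R) (h : R) (K : nat)
  (u : R -> torus d m -> torus d m -> R)
  (dspI : measure_display) (OmegaI : measurableType dspI)
  (PI : probability OmegaI R) (XI : R -> OmegaI -> torus d m)
  (dspG : measure_display) (OmegaG : measurableType dspG)
  (PG : probability OmegaG R) (XG : R -> OmegaG -> torus d m).
Local Notation J := (jumps b d m).
Local Notation sigma := (@jump b d m).
Local Notation lam := (jump_rate R b m).
Local Notation tg := (time_grid h).
Hypothesis m1 : (1 < m)%N.
Hypothesis pi_mu : is_coupling mu0 mu1 pi.
Hypothesis h0 : 0 < h.
Hypothesis u0 : forall t x y, 0 <= t <= 1 -> 0 <= u t x y.
Hypothesis XIP : interpolant PI (base_trans sigma lam) pi XI.
Hypothesis XGP : frozen_process PG mu0 tg K (frozen_generator sigma lam u tg) XG.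

Let mu k := law PI XI (tg k).
Let nu k := law PG XG (tg k).
Let a k z := op_rate sigma lam (score sigma lam pi) (tg k) z.
Let r k z := op_rate sigma lam u (tg k) z.
(** The entropic part of the expected loss as a real number, to be read on states where the
    approximate rates are positive; [loss_bound] secures this. *)
Let loss k : R := \sum_z mu k z *
  (if 0 < mu k z then \sum_s (a k z s * ln (a k z s / r k z s) - a k z s + r k z s) else 0).
Let err k : R := (6 * lam * d%:R * m%:R / (1 - tg k.+1)) ^+ 2 *
  (2 * ln (6 * m%:R / (1 - tg k.+1)) + 1).

Let pi0 x y : 0 <= pi x y. Proof. by case: pi_mu. Qed.

Let tgI k : 0 <= tg k <= 1.
Proof. by rewrite time_grid_ge0// ltW// time_grid_lt1. Qed.

Lemma interpolant_marginal t z : 0 <= t <= 1 ->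
  law PI XI t z = interp_marginal sigma lam pi t z.
Proof.
move=> tI; rewrite (interpolant_law z XIP tI); apply: eq_bigr => x0 _.
by apply: eq_bigr => x1 _; rewrite mulrCA.
Qed.

Let r_ge0 k z s : 0 <= r k z s.
Proof. by rewrite mulr_ge0 ?u0// ltW// jump_rate_gt0. Qed.

Let mu_ge0 k z : 0 <= mu k z. Proof. exact: law_ge0. Qed.

(** Absolute continuity is carried along the induction because the chain rule asks for it at each
    step. *)
Lemma relent_grid k : (k <= K)%N ->
  (forall k z s, (k < K)%N -> 0 < mu k z -> 0 < r k z s) ->
  (forall z, nu k z = 0 -> mu k z = 0) /\
  \sum_z mu k z * ln (mu k z / nu k z) <=
    \sum_(i < k) ((tg i.+1 - tg i) * loss i + (tg i.+1 - tg i) ^+ 2 * err i).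
Proof.
move=> kK rp; elim: k kK => [|k IH] kK.
  (* Both start from [mu0]: at time 0 the transition is the identity, and the positive
     [base_trans 1] cancels. *)
  have munu z : mu 0 z = nu 0 z.
    have tg0 : tg 0 = 0 by rewrite /time_grid expr0 invr1 subrr.
    have -> : nu 0 z = mu0 z.
      by rewrite /nu tg0 /law; case: XGP => _ -> _.
    rewrite /mu tg0 (interpolant_law z XIP) ?lexx ?ler01//.
    case: pi_mu => _ <- _; rewrite exchange_big/=; apply: eq_bigr => x1 _.
    rewrite (bigD1 z)//= big1 ?addr0 => [|x0 x0z].
      rewrite subr0 /base_trans semigroup0 /kid eqxx mul1r divff ?mulr1//.
      by rewrite gt_eqF// (@base_trans_gt0 _ b d m m1 1 z x1)// ltr01 lexx.
    by rewrite /base_trans semigroup0 /kid (negbTE x0z) !mul0r mulr0.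
  split; first by move=> z; rewrite munu.
  rewrite big_ord0 big1// => z _; rewrite munu.
  have [->|nz] := eqVneq (nu 0 z) 0; first by rewrite mul0r.
  by rewrite divff// ln1 mulr0.
have [munu IHk] := IH (ltnW kK).
pose p z := bridge_kernel b pi (tg k) (tg k.+1) z.
pose S z := semigroup (generator sigma (r k z)) (tg k.+1 - tg k) z.
have tauI : 0 <= tg k.+1 - tg k by rewrite subr_ge0 ltW// time_gridS.
have step z : 0 < mu k z ->
    [/\ forall y, 0 < p z y, \sum_y p z y = 1, forall y, 0 < S z y, forall s, 0 < a k z s &
    \sum_y p z y * ln (p z y / S z y) <=
      (tg k.+1 - tg k) * (\sum_s (a k z s * ln (a k z s / r k z s) - a k z s + r k z s)) +
      (tg k.+1 - tg k) ^+ 2 * err k].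
  move=> muz; apply: bridge_step => //.
  - by case/andP: (tgI k).
  - exact: time_gridS.
  - exact: time_grid_lt1.
  - by rewrite -interpolant_marginal.
  - by move=> s; exact: rp.
have muE y : mu k.+1 y = \sum_z mu k z * p z y.
  rewrite /mu interpolant_marginal// (@interp_marginal_step _ b d m m1 pi pi0 (tg k)).
    by apply: eq_bigr => z _; rewrite interpolant_marginal.
  by rewrite time_grid_lt1// andbT; case/andP: (tgI k).
have nuE y : nu k.+1 y = \sum_z nu k z * S z y.
  apply: (frozen_process_law (k := k) y XGP kK).
  - by move=> i; case/andP: (tgI i).
  - by move=> i; rewrite ltW// time_gridS.
  - exact: time_grid_le.
have [] := @relent_chain _ _ (mu k) (nu k) p S (mu_ge0 k) (fun z => law_ge0 PG XG (tg k) z) munu.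
- by move=> z y /step[].
- by move=> z y /step[].
- by move=> z y; exact: semigroup_generator_ge0.
- by move=> z /step[].
rewrite /= => ac H; split.
  by move=> y; rewrite nuE muE; exact: ac.
rewrite big_ord_recr/=; under eq_bigr do rewrite muE nuE.
apply: le_trans H _; apply: lerD => //.
(* The error does not depend on the state; total mass 1 spreads it so that both sides are compared
   state by state. *)
have mu_sum : \sum_z mu k z = 1 by case: XIP => mXI _; exact: law_sum1 mXI (tgI k).
rewrite -[_ ^+ 2 * err k]mul1r -mu_sum mulr_suml /loss mulr_sumr -big_split/=.
apply: ler_sum => z _; case: ifPn => muz; last first.
  have -> : mu k z = 0 by apply/eqP; rewrite eq_le mu_ge0 andbT leNgt.
  by rewrite !mul0r mulr0 addr0.
rewrite mulrCA -mulrDr ler_wpM2l//.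
by have [] := step z muz.
Qed.

Lemma score_loss_ge k z : (forall s, 0 < r k z s) ->
  ((\sum_s (a k z s * ln (a k z s / r k z s) - a k z s + r k z s))%:E <=
   score_loss sigma lam pi u (tg k) z)%E.
Proof.
move=> rp; rewrite -sumEFin; apply: lee_sum => s _.
by rewrite -/(a k z s) -/(r k z s) phi_perspE// leeDl// lee_fin sqr_ge0.
Qed.

Let a_ge0 k z s : 0 <= a k z s.
Proof.
have [t0 t1] := andP (tgI k).
apply: mulr_ge0; first by rewrite ltW// jump_rate_gt0.
apply: divr_ge0; last exact: interp_marginal_ge0.
apply: sumr_ge0 => x0 _; apply: sumr_ge0 => x1 _.
apply: mulr_ge0; last exact: pi_tilde_ge0.
by apply: mulr_ge0; apply: base_trans_ge0 => //; rewrite subr_ge0.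
Qed.

Let loss_ge0 k z : (0 <= score_loss sigma lam pi u (tg k) z)%E.
Proof. by apply: score_loss_ge0 => s; [exact: a_ge0|exact: r_ge0]. Qed.

Let Eloss k : (\int[PI]_w score_loss sigma lam pi u (tg k) (XI (tg k) w) =
  \sum_z (mu k z)%:E * score_loss sigma lam pi u (tg k) z)%E.
Proof. by case: XIP => mXI _; exact: integral_law mXI (tgI k) (loss_ge0 k). Qed.

(** Exact rates are positive at charged states, so a vanishing approximate rate there would make the
    loss infinite. Once the rates are positive, the extended-real loss dominates its real form. *)
Lemma loss_bound (eps : R) :
  (\sum_(k < K) (tg k.+1 - tg k)%:E *
     \int[PI]_w score_loss sigma lam pi u (tg k) (XI (tg k) w) <= (eps ^+ 2)%:E)%E ->
  (forall k z s, (k < K)%N -> 0 < mu k z -> 0 < r k z s) /\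
  \sum_(k < K) (tg k.+1 - tg k) * loss k <= eps ^+ 2.
Proof.
move=> H.
have tau0 k : 0 < tg k.+1 - tg k by rewrite subr_gt0 time_gridS.
have int0 k : (0 <= \int[PI]_w score_loss sigma lam pi u (tg k) (XI (tg k) w))%E.
  by apply: integral_ge0 => w _; exact: loss_ge0.
have rp k z s : (k < K)%N -> 0 < mu k z -> 0 < r k z s.
  move=> kK muz; rewrite lt_neqAle r_ge0 andbT; apply/negP => /eqP rE.
  have a0 : 0 < a k z s.
    (* Only the positivity of the exact rate is extracted; the reference rates are arbitrary, here
       1. *)
    have [] := @bridge_step _ b d m m1 pi pi0 (tg k) (tg k.+1) z (fun=> 1).
    - by case/andP: (tgI k).
    - exact: time_gridS.
    - exact: time_grid_lt1.
    - by rewrite -interpolant_marginal.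
    - by [].
    - by move=> _ _ _ + _; apply.
  have Ly : (score_loss sigma lam pi u (tg k) z = +oo)%E.
    apply/eqP; rewrite -leye_eq.
    apply: le_trans (@lee_sum_term _ _ _ s _); last first.
      by move=> i; rewrite adde_ge0 ?phi_persp_ge0 ?a_ge0 ?r_ge0// lee_fin sqr_ge0.
    rewrite -/(r k z s) -/(a k z s) -rE /phi_persp eqxx gt_eqF//.
  have : (+oo <= (eps ^+ 2)%:E)%E; last by [].
  apply: le_trans H; apply: le_trans (@lee_sum_term _ _ _ (Ordinal kK) _); last first.
    by move=> i; rewrite mule_ge0// lee_fin ltW.
  rewrite /= Eloss; have -> : (\sum_z (mu k z)%:E * score_loss sigma lam pi u (tg k) z = +oo)%E.
    apply/eqP; rewrite -leye_eq.
    apply: le_trans (@lee_sum_term _ _ _ z _); last first.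
      by move=> i; rewrite mule_ge0// lee_fin mu_ge0.
    by rewrite Ly gt0_muley// lte_fin.
  by rewrite gt0_muley// lte_fin.
split=> //; rewrite -lee_fin -sumEFin; apply: le_trans H; apply: lee_sum => k _.
rewrite EFinM lee_wpmul2l ?lee_fin ?(ltW (tau0 k))// Eloss /loss -sumEFin.
apply: lee_sum => z _; case: ifPn => muz; last first.
  by rewrite mulr0 mule_ge0// lee_fin mu_ge0.
rewrite EFinM lee_wpmul2l ?lee_fin ?mu_ge0// score_loss_ge// => s.
exact: rp.
Qed.

End Discretization.

(** * Summation over the grid *)

Theorem theorem2 (R : realType) :
  exists C : R, 0 < C /\
  forall (b : walk) (d m : nat) (mu0 mu1 : torus d m -> R)
    (pi : torus d m -> torus d m -> R)
    (eta h eps : R) (K : nat)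
    (u : R -> torus d m -> torus d m -> R)
    (dspI : measure_display) (OmegaI : measurableType dspI)
    (PI : probability OmegaI R) (XI : R -> OmegaI -> torus d m)
    (dspG : measure_display) (OmegaG : measurableType dspG)
    (PG : probability OmegaG R) (XG : R -> OmegaG -> torus d m),
    let sigma := @jump b d m in
    let lam := jump_rate R b m in
    let tg := time_grid h in
    (0 < d)%N -> (1 < m)%N ->
    is_prob mu0 -> is_prob mu1 -> is_coupling mu0 mu1 pi ->
    0 < eta < 1 -> 0 < h < 1 -> tg K = 1 - eta ->
    (forall t x y, 0 <= t <= 1 -> 0 <= u t x y) ->
    interpolant PI (base_trans sigma lam) pi XI ->
    frozen_process PG mu0 tg K (frozen_generator sigma lam u tg) XG ->
    0 <= eps ->
    (\sum_(k < K) (tg k.+1 - tg k)%:E *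
       \int[PI]_w score_loss sigma lam pi u (tg k) (XI (tg k) w)
     <= (eps ^+ 2)%:E)%E ->
    (KL (law PI XI (1 - eta)) (law PG XG (1 - eta)) <=
     (C * (m%:R ^+ 2 * eta ^- 2 * eps
             * (Num.sqrt #|jumps b d m|%:R + eps)
           + lam ^+ 2 * d%:R ^+ 2 * m%:R ^+ 2 * h * ln (eta^-1)
             * ln (m%:R * eta^-1)))%:E)%E.
Proof.
(* 720 is 36 * 10 * 2: the square of 6 in [L], the factor of [ln_harnack_le], and that of
   [grid_size_le]. *)
exists 720; split; first by rewrite ltr0n.
move=> b d m mu0 mu1 pi eta h eps K u dspI OmegaI PI XI dspG OmegaG PG XG sigma lam tg.
move=> d0 m1 _ _ pi_mu etaI hI tgK u0 XIP XGP eps0 H.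
have [h0 h1] := andP hI; have [eta0 eta1] := andP etaI.
have [rp lossB] := loss_bound m1 pi_mu h0 u0 XIP H.
have [ac D] := relent_grid m1 pi_mu h0 u0 XIP XGP (leqnn K) rp.
have m2 : 2 <= m%:R :> R by rewrite ler_nat.
have lam0 : 0 < lam by exact: jump_rate_gt0.
have lneta : 0 <= ln eta^-1 by rewrite ln_ge0// invf_ge1// ltW.
have me : 1 <= m%:R * eta^-1 :> R.
  rewrite -[1]mulr1; apply: ler_pM => //; first by lra.
  by rewrite invf_ge1// ltW.
have lnme : 0 <= ln (m%:R * eta^-1) by rewrite ln_ge0.
rewrite /KL -tgK -/tg ifT; last first.
  by apply/forallP => x; apply/implyP => /eqP /ac ->.
rewrite lee_fin; apply: le_trans D _; rewrite big_split/= mulrDr; apply: lerD.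
  apply: le_trans lossB _.
  have sq0 : 0 <= Num.sqrt (#|jumps b d m|%:R : R) by exact: sqrtr_ge0.
  (* The loss contributes at most [eps ^+ 2], which is below the first term since this prefactor is
     at least 1. *)
  have : 1 <= m%:R ^+ 2 * eta ^- 2 :> R.
    by rewrite -exprVn -exprMn exprn_ege1.
  set c := _ * eta ^- 2 => c1.
  apply: le_trans (_ : c * (eps * (Num.sqrt #|jumps b d m|%:R + eps)) <= _).
    rewrite expr2 -[leLHS]mul1r ler_pM ?mulr_ge0 ?addr_ge0//.
    by rewrite ler_wpM2l// lerDr.
  have : 0 <= c * (eps * (Num.sqrt #|jumps b d m|%:R + eps)).
    by apply: mulr_ge0; [exact: le_trans c1 | rewrite mulr_ge0 ?addr_ge0].
  rewrite -[c * eps * _]mulrA; set X := c * _; lra.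
set B := lam ^+ 2 * d%:R ^+ 2 * m%:R ^+ 2.
have B0 : 0 <= B by rewrite !mulr_ge0 ?exprn_ge0 ?(ltW lam0).
have etaE : (1 + h) ^- K = eta.
  by rewrite -onem_time_grid -/tg tgK; ring.
(* The squared step contains the squared remaining time, which cancels the denominator of [L ^+ 2];
   what is left is uniform in [k]. *)
have term (k : 'I_K) : (tg k.+1 - tg k) ^+ 2 *
    ((6 * lam * d%:R * m%:R / (1 - tg k.+1)) ^+ 2 * (2 * ln (6 * m%:R / (1 - tg k.+1)) + 1))
    <= h ^+ 2 * (36 * B) * (10 * ln (m%:R * eta^-1)).
  have s0 : 0 < 1 - tg k.+1 by rewrite subr_gt0 time_grid_lt1.
  rewrite /tg time_grid_step// -/tg [leLHS](_ : _ =
    h ^+ 2 * (36 * B) * (2 * ln (6 * m%:R / (1 - tg k.+1)) + 1)); last first.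
    by rewrite /B; field; rewrite gt_eqF.
  apply: ler_wpM2l.
    by apply: mulr_ge0; [rewrite exprn_ge0// ltW | rewrite mulr_ge0].
  apply: ln_harnack_le => //.
  rewrite -etaE -onem_time_grid lerD2l lerN2.
  exact: time_grid_le.
apply: le_trans (ler_sum _ (fun k _ => term k)) _.
rewrite sumr_const card_ord -mulr_natl.
have KH := grid_size_le hI eta0 etaE.
rewrite [leLHS](_ : _ = (360 * h * B * ln (m%:R * eta^-1)) * (K%:R * h)); last by ring.
rewrite [leRHS](_ : _ = (360 * h * B * ln (m%:R * eta^-1)) * (2 * ln eta^-1)); last by ring.
apply: ler_wpM2l; last exact: KH.
apply: mulr_ge0; last exact: lnme.
apply: mulr_ge0; last exact: B0.
by apply: mulr_ge0; [rewrite ler0n | exact: ltW].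
Qed.
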